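(* Let $(\mathcal M,\mathcal N,\mathcal D)$ be a full Cartan triple with faithful normal conditional expectation $E:\mathcal M\to\mathcal N$. Suppose $(0)\ne\mathcal B\subseteq\mathcal M$ is a weak-$*$-closed $\mathcal N$-bimodule. Then $\{0\}\neq\mathcal{GN}(\mathcal M,\mathcal D)\cap\mathcal B$. In fact, for every $x\in\mathcal B$ and $v\in\mathcal{GN}(\mathcal M,\mathcal D)$, the element $vE(v^*x)$ is a linear combination of at most four elements of $\mathcal{GN}(\mathcal M,\mathcal D)\cap\mathcal B$.
   Context: Von Neumann subalgebras are understood to contain the unit of the ambient algebra. For a von Neumann algebra $\mathcal M$ and a von Neumann subalgebra $\mathcal L\subseteq\mathcal M$, put $\mathcal{GN}(\mathcal M,\mathcal L)=\{v\in\mathcal M: v\text{ is a partial isometry and } v^*\mathcal Lv\cup v\mathcal Lv^*\subseteq\mathcal L\}$; $\mathcal L$ is regular in $\mathcal M$ if the linear span of $\mathcal{GN}(\mathcal M,\mathcal L)$ is weak-$*$ dense in $\mathcal M$. A Cartan triple $(\mathcal M,\mathcal N,\mathcal D)$ consists of von Neumann algebras such that (1) $\mathcal D$ is an abelian and regular von Neumann subalgebra of $\mathcal M$; (2) $\mathcal N$ is the relative commutant of $\mathcal D$ in $\mathcal M$; (3) there exists a faithful normal conditional expectation $E:\mathcal M\to\mathcal N$. It is full if $\mathcal D=\mathcal Z(\mathcal N)$, the center of $\mathcal N$. An $\mathcal N$-bimodule in $\mathcal M$ is a linear subspace $\mathcal B\subseteq\mathcal M$ with $\mathcal N\mathcal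 B\mathcal N\subseteq\mathcal B$. *)

(* Defs.v *)
From HB Require Import structures.
From mathcomp Require Import all_boot all_order all_algebra.
From mathcomp Require Import complex.
From mathcomp Require Import all_classical all_reals all_analysis.

Set Implicit Arguments.
Unset Strict Implicit.
Unset Printing Implicit Defensive.

Import Order.TTheory GRing.Theory Num.Theory numFieldNormedType.Exports.
Local Open Scope classical_set_scope.
Local Open Scope ring_scope.

(* Complex Hilbert spaces; the inner product is linear in its first argument
   and conjugate-linear in the second.  The norm takes values in R[i]. *)
Record hilbertType (R : realType) := Hilbert {
  hilbert_sort :> completeNormedModType R[i];
  inner : {dot hilbert_sort for @Num.conj R[i]};
  innerE : forall x, `|x| ^+ 2 = inner x x
}.

Section BoundedOperators.
Variables (R : realType) (H : hilbertType R).

Definition bounded_operator : {pred H -> H} :=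
  fun f => `[< linear f /\ continuous f >].

Record bop := Bop { bop_fun :> H -> H; bopP : bop_fun \in bounded_operator }.

HB.instance Definition _ := [isSub for bop_fun].
HB.instance Definition _ := [Choice of bop by <:].

Lemma bop_linear (T : bop) : linear T.
Proof. by have /asboolP[] := bopP T. Qed.

Lemma bop_continuous (T : bop) : continuous T.
Proof. by have /asboolP[] := bopP T. Qed.

Lemma bopE (S T : bop) : (forall x, S x = T x) -> S = T.
Proof. by move=> ST; apply/val_inj/funext. Qed.

Lemma bounded_operator_submod : submod_closed bounded_operator.
Proof.
split=> [|a f g /asboolP[fl fc] /asboolP[gl gc]]; apply/asboolP; split.
- by move=> c x y; rewrite /= scaler0 addr0.
- by move=> x; exact: cst_continuous.
- move=> c x y; change (a *: f (c *: x + y) + g (c *: x + y) =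
    c *: (a *: f x + g x) + (a *: f y + g y)).
  by rewrite fl gl !scalerDr !scalerA (mulrC c) addrACA.
- move=> x; apply: continuousD; last exact: gc.
  by apply: continuousZr => //; exact: fc.
Qed.

HB.instance Definition _ :=
  GRing.isSubmodClosed.Build _ _ bounded_operator bounded_operator_submod.
HB.instance Definition _ := [SubChoice_isSubLmodule of bop by <:].

Lemma bop_idP : id \in bounded_operator.
Proof. by apply/asboolP; split=> [//|x]; exact: cvg_id. Qed.

Lemma bop_compP (S T : bop) : (S \o T) \in bounded_operator.
Proof.
apply/asboolP; split=> [c x y|x]; first by rewrite /= !bop_linear.
by apply: continuous_comp; exact: bop_continuous.
Qed.

Definition bop_one := Bop bop_idP.
Definition bop_mul (S T : bop) := Bop (bop_compP S T).

Lemma bop_mulA : associative bop_mul. Proof. by move=> S T U; apply: bopE. Qed.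
Lemma bop_mul1l : left_id bop_one bop_mul. Proof. by move=> S; apply: bopE. Qed.
Lemma bop_mul1r : right_id bop_one bop_mul. Proof. by move=> S; apply: bopE. Qed.
Lemma bop_mulDl : left_distributive bop_mul +%R.
Proof. by move=> S T U; apply: bopE. Qed.
Lemma bop_mulDr : right_distributive bop_mul +%R.
Proof.
move=> S T U; apply: bopE => x.
by have := bop_linear S 1 (T x) (U x); rewrite !scale1r.
Qed.

HB.instance Definition _ := GRing.Zmodule_isPzRing.Build bop
  bop_mulA bop_mul1l bop_mul1r bop_mulDl bop_mulDr.

(* By Riesz representation such an operator exists; it is then unique. *)
Definition adj (T : bop) : bop :=
  xget 0 [set S : bop | forall x y, inner H (T x) y = inner H x (S y)].

(* The predual of B(H): the normal functionals are the
   T |-> \sum_n <T xi_n, eta_n> with xi and eta square-summable. *)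
Definition square_summable (xi : nat -> H) :=
  cvgn (series (fun n => `|xi n| ^+ 2) : nat -> R[i]^o).

Record l2seq := L2seq {
  l2seq_fun :> nat -> H; l2seqP : square_summable l2seq_fun }.

Definition normal_functional (T : bop) (xe : l2seq * l2seq) : R[i]^o :=
  limn (series (fun n => inner H (T (xe.1 n)) (xe.2 n)) : nat -> R[i]^o).

(* B(H) carries the weak-* topology as its canonical topology. *)
HB.instance Definition _ := Topological.copy bop
  (initial_topology (normal_functional : bop -> {ptws l2seq * l2seq -> R[i]^o})).

Definition pos_op (T : bop) := forall x, 0 <= inner H (T x) x.

Definition is_projection (p : bop) := adj p = p /\ p * p = p.

Definition partial_isometry (v : bop) := is_projection (adj v * v).

Definition lspan (A : set bop) : set bop :=
  [set T | exists n (c : 'I_n -> R[i]) (a : 'I_n -> bop),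
     (forall i, A (a i)) /\ T = \sum_(i < n) c i *: a i].

Definition commutant (A : set bop) : set bop :=
  [set T | forall S, A S -> T * S = S * T].

(* A *-closed set equal to its bicommutant; it is then a unital *-subalgebra of
   B(H), so the inclusions below preserve the unit. *)
Definition von_neumann (M : set bop) :=
  (forall T, M T -> M (adj T)) /\ commutant (commutant M) = M.

Definition vn_subalgebra (L M : set bop) := von_neumann L /\ L `<=` M.

Definition vn_abelian (L : set bop) := forall S T, L S -> L T -> S * T = T * S.

Definition vn_center (N : set bop) : set bop := N `&` commutant N.

Definition GN (M L : set bop) : set bop :=
  [set v | [/\ M v, partial_isometry v &
     [set adj v * d * v | d in L] `|` [set v * d * adj v | d in L] `<=` L]].

Definition vn_regular (M L : set bop) := M `<=` closure (lspan (GN M L)).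

(* Only the values of E on M matter. *)
Record cond_exp (M N : set bop) (E : bop -> bop) : Prop := {
  cond_exp_in : forall x, M x -> N (E x);
  cond_exp_lin : forall (c : R[i]) x y, M x -> M y ->
    E (c *: x + y) = c *: E x + E y;
  cond_exp_id : forall n, N n -> E n = n;
  cond_exp_bimod : forall m n x, N m -> N n -> M x ->
    E (m * x * n) = m * E x * n;
  cond_exp_pos : forall x, M x -> pos_op x -> pos_op (E x)
}.

Definition faithful_on (M : set bop) (E : bop -> bop) :=
  forall x, M x -> pos_op x -> E x = 0 -> x = 0.

(* Continuity for the (relative) weak-* topologies. *)
Definition normal_on (M : set bop) (E : bop -> bop) := {within M, continuous E}.

Definition fn_cond_exp (M N : set bop) (E : bop -> bop) :=
  [/\ cond_exp M N E, faithful_on M E & normal_on M E].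

Record cartan_triple (M N D : set bop) : Prop := {
  cartan_vn : von_neumann M;
  cartan_sub_N : vn_subalgebra N M;
  cartan_sub_D : vn_subalgebra D M;
  cartan_abelian : vn_abelian D;
  cartan_regular : vn_regular M D;
  cartan_rel_commutant : N = M `&` commutant D;
  cartan_exp : exists E, fn_cond_exp M N E
}.

Definition full_cartan_triple (M N D : set bop) :=
  cartan_triple M N D /\ D = vn_center N.

Record bimodule (N M B : set bop) : Prop := {
  bimodule_sub : B `<=` M;
  bimodule0 : B 0;
  bimodule_lin : forall (c : R[i]) x y, B x -> B y -> B (c *: x + y);
  bimodule_mul : forall m n x, N m -> N n -> B x -> B (m * x * n)
}.

End BoundedOperators.

(* Main.v *)
Require Import Defs.
From mathcomp Require Import all_boot all_order all_algebra.
From mathcomp Require Import complex.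
From mathcomp Require Import all_classical all_reals all_analysis.
From HB Require Import structures.
From mathcomp Require Import ring lra.
Set Implicit Arguments.
Unset Strict Implicit.
Unset Printing Implicit Defensive.
Import Order.TTheory GRing.Theory Num.Theory numFieldNormedType.Exports.
Local Open Scope classical_set_scope.
Local Open Scope ring_scope.

(** Fix v in GN(M, D) and x in B, and write y = v^* x.  The argument has three
    parts.

    The element v E(y) lies in B ([expectation_in_bimodule]).  For a unitary u
    of D one has v (u y u^* ) = (v u v^* ) (v y) u^*, which is in B because
    v u v^* and u^* are in N.  So B contains v S for every average S of the
    conjugates u y u^*, and E(S) = E(y) because N commutes with D.  Bounded
    sets of operators are weak-* relatively compact, and the unitaries of D
    commute, so such averages have a weak-* limit point z that is fixed by all
    these conjugations (the argument of Markov and Kakutani).  As D is spanned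
    by its unitaries, z is in the relative commutant N of D, hence
    z = E(z) = E(y) by normality of E, while v z is in B as B is closed.

    The element v E(y) decomposes ([expectation_decomposition]).  The set J of
    the n in N with v n in B is a weak-* closed two-sided ideal of N, so it has
    a unit z, which is a projection of the center D of N ([central_support]).
    Write n = E(y) as a combination of four unitaries u_i of N
    ([four_unitaries]).  Then v n = v z n is the same combination of the
    v z u_i.  These are in B because z is in J, and in GN(M, D) because u_i
    commutes with D ([GN_mul_unitary]).

    Some v E(v^* x) is nonzero when x is ([expectation_separates]).  If all
    vanish, then E(w x) = 0 for every w in GN(M, D), hence for every w in M by
    regularity and normality.  Taking w = x^* and using that E is faithful
    gives x = 0.

    These parts rest on classical facts about B(H), developed here from the
    Hilbert space axioms: the Riesz representation theorem, the existence of
    adjoints, the weak-* compactness of balls, square roots of 1 - h^2, and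
    approximate units of ideals. *)

(** * Complex numbers and norms with real values *)

Section RealToComplex.
Variable R : realType.
Implicit Types a b : R.
Lemma realcM a b : (a * b)%:C%C = a%:C%C * b%:C%C :> R[i].
Proof. exact: rmorphM. Qed.
Lemma realcD a b : (a + b)%:C%C = a%:C%C + b%:C%C :> R[i].
Proof. exact: rmorphD. Qed.
Lemma realcB a b : (a - b)%:C%C = a%:C%C - b%:C%C :> R[i].
Proof. exact: rmorphB. Qed.
Lemma realcn n : (n%:R : R)%:C%C = n%:R :> R[i].
Proof. exact: rmorph_nat. Qed.
End RealToComplex.

(** The norms of complex spaces take values in R[i]; the real value makes the
    order total, so that real arithmetic applies. *)
Definition nm (R : realType) (V : normedZmodType R[i]) (x : V) : R :=
  complex.Re `|x|.

Section RealNorm.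
Variables (R : realType) (V : normedZmodType R[i]).
Implicit Types x y : V.

Lemma nmE x : `|x| = (nm x)%:C%C.
Proof. by rewrite /nm RRe_real // normr_real. Qed.

Lemma nm_ge0 x : 0 <= nm x.
Proof. by have := normr_ge0 x; rewrite nmE ler0c. Qed.

Lemma nm0 : nm (0 : V) = 0.
Proof. by rewrite /nm normr0. Qed.

Lemma nm0_eq0 x : nm x = 0 -> x = 0.
Proof. by move=> x0; apply/normr0_eq0; rewrite nmE x0. Qed.

Lemma nm_triangle x y : nm (x + y) <= nm x + nm y.
Proof. by have := ler_normD x y; rewrite !nmE -raddfD lecR. Qed.

Lemma nmN x : nm (- x) = nm x.
Proof. by rewrite /nm normrN. Qed.

Lemma nmBC x y : nm (x - y) = nm (y - x).
Proof. by rewrite /nm distrC. Qed.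

End RealNorm.

Lemma nmZ (R : realType) (V : normedModType R[i]) (c : R[i]) (x : V) :
  nm (c *: x) = nm c * nm x.
Proof. by apply: complexI; rewrite rmorphM /= -!nmE normrZ. Qed.

Lemma nm_real (R : realType) (a : R) : 0 <= a -> nm (a%:C%C) = a.
Proof. by move=> a0; rewrite /nm ger0_norm // ler0c. Qed.

Lemma nm_conj (R : realType) (z : R[i]) : nm (z^*) = nm z.
Proof. by rewrite /nm norm_conjC. Qed.

Lemma Re_le_nm (R : realType) (z : R[i]) : `|complex.Re z| <= nm z.
Proof. by have := normc_ge_Re z; rewrite nmE lecR. Qed.

Lemma Im_le_nm (R : realType) (z : R[i]) : `|complex.Im z| <= nm z.
Proof.
case: z => a b /=; rewrite /nm normc_def /= -sqrtr_sqr ler_wsqrtr //.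
by rewrite lerDr sqr_ge0.
Qed.

Lemma nm_le_ReIm (R : realType) (z : R[i]) :
  nm z <= `|complex.Re z| + `|complex.Im z|.
Proof.
case: z => a b /=; rewrite /nm normc_def /= -[leRHS]ger0_norm ?addr_ge0 //.
rewrite -sqrtr_sqr ler_wsqrtr // sqrrD !real_normK ?num_real //.
by rewrite lerD2r lerDl mulrn_wge0 // mulr_ge0.
Qed.

(** * Limits in complex normed spaces *)

Section RealCvg.
Variables (R : realType) (V : normedModType R[i]).

Lemma cvg_nmP (T : Type) (F : set_system T) {FF : Filter F} (f : T -> V) (l : V) :
  f @ F --> l <-> forall e : R, 0 < e -> \forall x \near F, nm (l - f x) < e.
Proof.
split=> [/cvgrPdist_lt fl e e0|fl].
  have /fl : 0 < e%:C%C :> R[i] by rewrite ltcR.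
  by apply: filterS => x; rewrite nmE ltcR.
apply/cvgrPdist_lt => e e0.
have er : e = (complex.Re e)%:C%C by rewrite RRe_real // gtr0_real.
have /fl : 0 < complex.Re e by rewrite -ltcR -er.
by apply: filterS => x; rewrite nmE er ltcR.
Qed.

Lemma normed_cvg_unique (T : Type) (F : set_system T) {FF : ProperFilter F}
  (f : T -> V) (l l' : V) : f @ F --> l -> f @ F --> l' -> l = l'.
Proof. by move=> fl fl'; exact: cvg_unique fl fl'. Qed.

Lemma nm_cvg (F : set_system V) {FF : Filter F} (l : V) :
  F --> l -> (fun x => nm x : R^o) @ F --> (nm l : R^o).
Proof.
move=> Fl; apply/cvgrPdist_lt => e e0.
have /cvg_nmP/(_ e e0) : (id : V -> V) @ F --> l by [].
apply: filterS => x; apply: le_lt_trans.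
have := nm_triangle (x - l) l; have := nm_triangle (l - x) x.
by rewrite !subrK (nmBC x) ler_norml => h1 h2; apply/andP; split; lra.
Qed.

End RealCvg.

Lemma bounded_continuous (R : realType) (V W : normedModType R[i]) (f : V -> W) r :
  linear f -> (forall x, nm (f x) <= r * nm x) -> continuous f.
Proof.
move=> fl fb.
pose L := GRing.isLinear.Build _ _ _ _ f fl.
pose g : {linear V -> W} := HB.pack f L.
apply: (@bounded_linear_continuous _ _ _ g); apply/linear_boundedP.
exists r%:C%C; split; first by rewrite complex_real.
move=> M rM x; apply: (@le_trans _ _ (r%:C%C * `|x|)); last by rewrite ler_wpM2r // ltW.
by rewrite !nmE -realcM lecR.
Qed.

Lemma cvg_ReIm (R : realType) (T : Type) (F : set_system T) {FF : Filter F}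
    (f : T -> R[i]^o) (a b : R^o) :
  (fun x => complex.Re (f x)) @ F --> a -> (fun x => complex.Im (f x)) @ F --> b ->
  f @ F --> ((a +i* b)%C : R[i]^o).
Proof.
move=> fa fb; apply/cvg_nmP => e e0.
have e20 : 0 < e / 2 by rewrite divr_gt0.
move/cvgrPdist_lt : fa => /(_ _ e20) fa; move/cvgrPdist_lt : fb => /(_ _ e20) fb.
apply: filterS2 fa fb => i /= fa fb.
apply: le_lt_trans (nm_le_ReIm _) _; rewrite (splitr e).
by case: (f i) fa fb => x y /= fa fb; apply: ltrD.
Qed.

Lemma ultra_cvg_real (R : realType) (I : Type) (F : set_system I)
  {FU : UltraFilter F} (f : I -> R) (r : R) :
  (\forall i \near F, `|f i| <= r) -> exists l : R^o, f @ F --> l.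
Proof.
move=> fr.
have : compact `[-r, r]%classic by exact: segment_compact.
move=> /(_ (f @ F) _) [|l [_ cl]].
  by apply: filterS fr => i; rewrite /= in_itv /= ler_norml.
exists l => A lA; change (F (f @^-1` A)).
have [//|FA] := in_ultra_setVsetC (f @^-1` A) FU.
have : (f @ F) (~` A) by [].
by move=> /cl /(_ lA) [x []].
Qed.

Lemma ultra_cvg_complex (R : realType) (I : Type) (F : set_system I)
  {FU : UltraFilter F} (f : I -> R[i]) (r : R) :
  (\forall i \near F, nm (f i) <= r) -> exists l : R[i]^o, (f : I -> R[i]^o) @ F --> l.
Proof.
move=> fr.
have [|a fa] := @ultra_cvg_real R I F FU (fun i => complex.Re (f i)) r.
  by apply: filterS fr => i; apply: le_trans; exact: Re_le_nm.
have [|b fb] := @ultra_cvg_real R I F FU (fun i => complex.Im (f i)) r.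
  by apply: filterS fr => i; apply: le_trans; exact: Im_le_nm.
by exists (a +i* b)%C; exact: cvg_ReIm.
Qed.

(** Absolute convergence suffices, by comparison on the real and imaginary
    parts separately. *)
Lemma complex_series_cvg (R : realType) (u : nat -> R[i]^o) :
  (exists l : R^o, series (fun n => nm (u n)) @ \oo --> l) ->
  exists l : R[i]^o, series u @ \oo --> l.
Proof.
move=> [l ul].
have cvRI (p : R[i] -> R) : (forall z, `|p z| <= nm z) -> {morph p : x y / x + y} ->
    p 0 = 0 -> exists a : R^o, (fun n => p (series u n)) @ \oo --> a.
  move=> pn pD p0.
  have -> : (fun n => p (series u n)) = series (fun n => p (u n)).
    apply/funext => n; rewrite /series /=.
    exact: (big_morph p pD p0).
  have : cvgn (series (fun n => p (u n))).
    apply: normed_cvg.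
    apply: (@series_le_cvg _ _ (fun n => nm (u n))) => [n|n|n|].
    - by rewrite normr_ge0.
    - exact: nm_ge0.
    - exact: pn.
    - by apply/cvg_ex; exists l.
  by move=> /cvg_ex.
have [||a fa] := cvRI (@complex.Re R) (@Re_le_nm R).
- by move=> [? ?] [? ?].
- by [].
have [||b fb] := cvRI (@complex.Im R) (@Im_le_nm R).
- by move=> [? ?] [? ?].
- by [].
by exists (a +i* b)%C; exact: cvg_ReIm.
Qed.

(** * Hilbert spaces and the Riesz representation theorem *)

Section Hilbert.
Variables (R : realType) (H : hilbertType R).
Implicit Types x y z : H.
Local Notation ip := (inner H).

Lemma ipDl x y z : ip (x + y) z = ip x z + ip y z.
Proof. exact: linearDl. Qed.
Lemma ipZl (c : R[i]) x y : ip (c *: x) y = c * ip x y.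
Proof. exact: linearZl_LR. Qed.
Lemma ipNl x y : ip (- x) y = - ip x y.
Proof. exact: linearNl. Qed.
Lemma ipBl x y z : ip (x - y) z = ip x z - ip y z.
Proof. exact: linearBl. Qed.
Lemma ip0l x : ip 0 x = 0.
Proof. exact: linear0l. Qed.
Lemma ipDr x y z : ip x (y + z) = ip x y + ip x z.
Proof. exact: linearDr. Qed.
Lemma ipZr (c : R[i]) x y : ip x (c *: y) = c^* * ip x y.
Proof. exact: linearZr_LR. Qed.
Lemma ipNr x y : ip x (- y) = - ip x y.
Proof. exact: linearNr. Qed.
Lemma ipBr x y z : ip x (y - z) = ip x y - ip x z.
Proof. exact: linearBr. Qed.
Lemma ip0r x : ip x 0 = 0.
Proof. exact: linear0r. Qed.
Lemma ipC x y : ip y x = (ip x y)^*.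
Proof. by rewrite hermC /= expr0 mul1r. Qed.

Lemma ip_nm x : ip x x = (nm x ^+ 2)%:C%C.
Proof. by rewrite -innerE nmE -rmorphXn. Qed.

Lemma ip_inj x y : (forall z, ip x z = ip y z) -> x = y.
Proof.
move=> xy; apply/subr0_eq/nm0_eq0/eqP; rewrite -sqrf_eq0; apply/eqP/complexI.
by rewrite -ip_nm ipBl xy subrr.
Qed.

Lemma ip_eq0 x : (ip x x == 0) = (x == 0).
Proof.
rewrite ip_nm -[0]/(0%:C%C) (inj_eq (@complexI R)) sqrf_eq0.
by apply/eqP/eqP => [/nm0_eq0//|->]; rewrite nm0.
Qed.

Lemma ip_gt0 x : x != 0 -> 0 < ip x x.
Proof. by rewrite lt_def ip_eq0 => -> /=; rewrite ip_nm ler0c sqr_ge0. Qed.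

(** Pythagoras for the component of x orthogonal to y.  It gives the
    Cauchy-Schwarz inequality, and in Riesz's theorem the orthogonality of the
    shortest vector to the kernel. *)
Lemma ip_sub_proj x y : y != 0 ->
  let p := x - (ip x y / ip y y) *: y in
  ip p p = ip x x - `|ip x y| ^+ 2 / ip y y.
Proof.
rewrite -ip_eq0 => yy.
have yyr : (ip y y)^* = ip y y by rewrite -ipC.
rewrite /= !(ipBl, ipBr, ipZl, ipZr) rmorphM fmorphV /= yyr (ipC x y) normCK.
by field.
Qed.

Lemma cauchy_schwarz x y : nm (ip x y) <= nm x * nm y.
Proof.
have [->|y0] := eqVneq y 0; first by rewrite ip0r !nm0 mulr0.
rewrite -ler_sqr ?nnegrE ?mulr_ge0 ?nm_ge0 // exprMn -lecR.
have -> : (nm (ip x y) ^+ 2)%:C%C = `|ip x y| ^+ 2 by rewrite nmE rmorphXn.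
rewrite realcM -!ip_nm -ler_pdivrMr ?ip_gt0 // -subr_ge0 -(ip_sub_proj _ y0) ip_nm.
by rewrite ler0c sqr_ge0.
Qed.

Lemma parallelogram x y :
  nm (x - y) ^+ 2 = 2 * nm x ^+ 2 + 2 * nm y ^+ 2 - nm (x + y) ^+ 2.
Proof.
apply: complexI; rewrite realcB realcD (realcM 2) (realcM 2 (nm y ^+ 2)) realcn.
rewrite -!ip_nm !(ipBl,ipBr,ipDl,ipDr).
by ring.
Qed.

(** By the parallelogram law, points of A whose norms are close to the infimum
    are close to each other, because their midpoint is in A as well: they form
    a Cauchy filter. *)
Lemma least_norm_point (A : set H) : A !=set0 -> closed A ->
  (forall x y, A x -> A y -> A (2^-1 *: (x + y))) ->
  exists2 w, A w & forall x, A x -> nm w <= nm x.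
Proof.
move=> [x0 Ax0] clA midA.
pose D := [set nm x ^+ 2 | x in A].
have infD : has_inf D.
  split; first by exists (nm x0 ^+ 2); exists x0.
  by exists 0 => _ [x _ <-]; rewrite sqr_ge0.
pose d := inf D.
have dle x : A x -> d <= nm x ^+ 2 by move=> Ax; apply: ge_inf; [case: infD|exists x].
pose near_inf e := [set x | A x /\ nm x ^+ 2 < d + e].
pose F := filter_from [set e : R | 0 < e] near_inf.
have FF : ProperFilter F.
  apply: filter_from_proper; last first.
    by move=> e /= e0; have [_ [x Ax <-] xe] := inf_adherent e0 infD; exists x.
  apply: filter_from_filter; first by exists 1 => /=.
  move=> e1 e2 /= e10 e20; exists (Num.min e1 e2); first by rewrite /= lt_min e10.
  move=> x [Ax xe]; split; split => //; apply: lt_le_trans xe _.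
    by rewrite lerD2l ge_min lexx.
  by rewrite lerD2l ge_min lexx orbT.
have Fd e : 0 < e -> F (near_inf e) by exists e.
have : cvg F.
  apply: cauchy_cvg; apply/cauchy_ballP => e e0.
  have er : e = (complex.Re e)%:C%C by rewrite RRe_real // gtr0_real.
  have e0' : 0 < complex.Re e by rewrite -ltcR -er.
  set e' := complex.Re e in er e0'.
  (* If |x|^2 and |y|^2 are below d + eps, then |x - y|^2 < 4 eps. *)
  pose eps := e' ^+ 2 / 4.
  have eps0 : 0 < eps by rewrite divr_gt0 // exprn_gt0.
  exists (near_inf eps, near_inf eps); first by split; exact: Fd.
  move=> [x y] /= [[Ax xe] [Ay ye]].
  rewrite -ball_normE /ball_ /= nmE er ltcR.
  rewrite -ltr_sqr ?nnegrE ?nm_ge0 ?ltW // parallelogram.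
  have := dle _ (midA x y Ax Ay).
  have -> : nm (2^-1 *: (x + y)) = 2^-1 * nm (x + y).
    by rewrite nmZ -(realcn R 2) -fmorphV nm_real // invr_ge0.
  move: xe ye; rewrite /eps.
  move: (nm x ^+ 2) (nm y ^+ 2) (nm (x + y)) => X Y Z; nra.
move=> /cvg_ex[w Fw]; exists w.
  by apply: (@closed_cvg _ _ F FF id A clA _ _ Fw); apply: filterS (Fd 1 ltr01) => x [].
move=> x Ax; rewrite -ler_sqr ?nnegrE ?nm_ge0 //; apply: le_trans (dle _ Ax).
apply/ler_addgt0Pr => e e0.
have nw2 : (fun x => nm x ^+ 2 : R^o) @ F --> (nm w ^+ 2 : R^o).
  by apply: cvgM; exact: nm_cvg.
apply: (@closed_cvg _ _ F FF _ _ (@closed_le R (d + e)) _ _ nw2).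
by apply: filterS (Fd e e0) => y [_ /ltW].
Qed.

(** The representing vector is a multiple of the shortest vector w on the
    hyperplane f = 1: w is orthogonal to the kernel of f, since otherwise
    subtracting a projection would shorten it. *)
Lemma riesz (f : H -> R[i]) r : linear (f : H -> R[i]^o) ->
  (forall x, nm (f x) <= r * nm x) -> exists w, forall x, f x = ip x w.
Proof.
move=> fl fr.
have [f0|] := pselect (forall x, f x = 0).
  by exists 0 => x; rewrite f0 ip0r.
move=> /existsNP[x0 /eqP fx0].
have fD x y : f (x + y) = f x + f y by have := fl 1 x y; rewrite !scale1r.
have f0 : f 0 = 0 by apply: (@addrI _ (f 0)); rewrite -fD !addr0.
have fZ c x : f (c *: x) = c * f x by have := fl c x 0; rewrite !addr0 f0 addr0.
have fB x y : f (x - y) = f x - f y by rewrite fD -scaleN1r fZ mulN1r.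
pose A := f @^-1` [set 1].
have [|||w Aw wmin] := @least_norm_point A.
- by exists ((f x0)^-1 *: x0); rewrite /A /= fZ mulVf.
- apply: (@closed_comp _ (R[i]^o)); last first.
    exact/accessible_closed_set1/hausdorff_accessible/norm_hausdorff.
  by move=> x _; exact: (@bounded_continuous _ _ _ (f : H -> R[i]^o) r fl fr).
- by move=> x y Ax Ay; rewrite /A /= fZ fD Ax Ay -(natrD _ 1 1) mulVf.
have w0 : w != 0.
  by apply: contra_eq_neq Aw => ->; rewrite /= f0 eq_sym oner_eq0.
have ker y : f y = 0 -> ip y w = 0.
  have [->|y0 fy] := eqVneq y 0; first by rewrite ip0l.
  have : nm w <= nm (w - (ip w y / ip y y) *: y).
    by apply: wmin; rewrite /A /= fB fZ fy mulr0 subr0.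
  rewrite -ler_sqr ?nnegrE ?nm_ge0 // -lecR -!ip_nm ip_sub_proj //.
  rewrite lerBrDl gerDr pmulr_lle0 ?invr_gt0 ?ip_gt0 // => wy.
  have : `|ip w y| ^+ 2 == 0 by rewrite eq_le wy exprn_ge0.
  by rewrite sqrf_eq0 normr_eq0 (ipC w y) => /eqP ->; rewrite conjC0.
exists ((ip w w)^-1 *: w) => x.
have := ker (x - f x *: w); rewrite fB fZ Aw mulr1 subrr => /(_ erefl).
rewrite ipBl ipZl => /eqP; rewrite subr_eq0 => /eqP xw.
have wwr : (ip w w)^* = ip w w by rewrite -ipC.
by rewrite ipZr fmorphV /= wwr xw mulrC mulfK // ip_eq0.
Qed.

End Hilbert.

(** * Bounded operators and adjoints *)

Section Operators.
Variables (R : realType) (H : hilbertType R).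
Implicit Types (x y z : H) (S T U : bop H) (r : R) (c : R[i]).
Local Notation ip := (inner H).

Definition bdd r T := forall x, nm (T x) <= r * nm x.

Lemma bopD T x y : T (x + y) = T x + T y.
Proof. by have := bop_linear T 1 x y; rewrite !scale1r. Qed.
Lemma bopx0 T : T 0 = 0.
Proof. by apply: (@addrI _ (T 0)); rewrite -bopD !addr0. Qed.
Lemma bopZ T c x : T (c *: x) = c *: T x.
Proof. by have := bop_linear T c x 0; rewrite bopx0 !addr0. Qed.
Lemma bop_addE S T x : (S + T) x = S x + T x. Proof. by []. Qed.
Lemma bop_oppE T x : (- T) x = - T x. Proof. by []. Qed.
Lemma bop_subE S T x : (S - T) x = S x - T x. Proof. by []. Qed.
Lemma bop_scaleE c T x : (c *: T) x = c *: T x. Proof. by []. Qed.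
Lemma bop_mulE S T x : (S * T) x = S (T x). Proof. by []. Qed.
Lemma bop_1E x : (1 : bop H) x = x. Proof. by []. Qed.
Lemma bop_0E x : (0 : bop H) x = 0. Proof. by []. Qed.
Lemma bop_scaleAl c S T : c *: (S * T) = (c *: S) * T.
Proof. exact: bopE. Qed.
Lemma bop_scaleAr c S T : c *: (S * T) = S * (c *: T).
Proof. by apply: bopE => x; rewrite bop_mulE !bop_scaleE bopZ. Qed.

Lemma bop_bdd T : exists2 r, 0 <= r & bdd r T.
Proof.
pose L := GRing.isLinear.Build _ _ _ _ (T : H -> H) (bop_linear T).
pose f : {linear H -> H} := HB.pack (T : H -> H) L.
have /continuous_linear_bounded/linear_boundedP : {for 0, continuous f} by exact: (@bop_continuous _ _ T 0).
move=> [M [Mr]] /(_ (M + 1)); rewrite ltrDl ltr01 => /(_ erefl) fM.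
have M1r : M + 1 = (complex.Re (M + 1))%:C%C by rewrite RRe_real // realD ?real1.
set r := complex.Re (M + 1) in M1r.
have bT : bdd r T by move=> x; have := fM x; rewrite M1r !nmE -realcM lecR.
exists (Num.max r 0); first by rewrite le_max lexx orbT.
move=> x; apply: le_trans (bT x) _; rewrite ler_wpM2r ?nm_ge0 //.
by rewrite le_max lexx.
Qed.

Lemma bdd_le r r' T : r <= r' -> bdd r T -> bdd r' T.
Proof. by move=> rr bT x; apply: le_trans (bT x) _; rewrite ler_wpM2r ?nm_ge0. Qed.

Lemma bddD r r' S T : bdd r S -> bdd r' T -> bdd (r + r') (S + T).
Proof.
move=> bS bT x; rewrite bop_addE mulrDl; apply: le_trans (nm_triangle _ _) _.
exact: lerD.
Qed.

Lemma bddM r r' S T : 0 <= r -> bdd r S -> bdd r' T -> bdd (r * r') (S * T).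
Proof.
move=> r0 bS bT x; apply: le_trans (bS _) _; rewrite -mulrA ler_wpM2l //.
Qed.

Lemma bddZ c r T : bdd r T -> bdd (nm c * r) (c *: T).
Proof. by move=> bT x; rewrite bop_scaleE nmZ -mulrA ler_wpM2l ?nm_ge0. Qed.

Lemma bddN r T : bdd r T -> bdd r (- T).
Proof. by move=> bT x; rewrite bop_oppE nmN. Qed.

Lemma bdd1 : bdd 1 (1 : bop H).
Proof. by move=> x; rewrite bop_1E mul1r. Qed.

Lemma bdd0 : bdd 0 (0 : bop H).
Proof. by move=> x; rewrite bop_0E nm0 mul0r. Qed.

Lemma bdd_nearly0 T : (forall e : R, 0 < e -> bdd e T) -> T = 0.
Proof.
move=> T0; apply: bopE => x; rewrite bop_0E; apply: nm0_eq0.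
apply/eqP; rewrite eq_le nm_ge0 andbT; apply/ler_addgt0Pr => e e0; rewrite add0r.
have n1 : 0 < nm x + 1 by rewrite ltr_wpDl ?nm_ge0.
apply: le_trans (T0 (e / (nm x + 1)) _ x) _; first by rewrite divr_gt0.
by rewrite mulrAC -mulrA ler_piMr ?ltW // ltr_pdivrMr // mul1r ltrDl.
Qed.

Lemma bop_of_bounded (f : H -> H) r : linear f -> (forall x, nm (f x) <= r * nm x) ->
  exists2 T : bop H, bdd r T & (forall x, T x = f x).
Proof.
move=> fl fb; have cf := bounded_continuous fl fb.
have fP : f \in @bounded_operator R H by apply/asboolP; split.
by exists (Bop fP).
Qed.

(** Riesz's theorem applied to the conjugate of each b x. *)
Lemma bounded_form_op (b : H -> H -> R[i]) r :
  (forall c x x' y, b (c *: x + x') y = c * b x y + b x' y) ->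
  (forall c x y y', b x (c *: y + y') = c^* * b x y + b x y') ->
  (forall x y, nm (b x y) <= r * nm x * nm y) ->
  exists2 T : bop H, bdd r T & forall x y, ip (T x) y = b x y.
Proof.
move=> bl br bb.
have W x : exists w, forall y, b x y = ip w y.
  have [||w wE] := @riesz R H (fun y => (b x y)^*) (r * nm x).
  - by move=> c y y'; rewrite br rmorphD rmorphM /= conjCK.
  - by move=> y; rewrite nm_conj.
  by exists w => y; rewrite ipC -wE conjCK.
have [f fE] := choice W.
have [||T bT TE] := @bop_of_bounded f r.
- by move=> c x x'; apply: ip_inj => z; rewrite ipDl ipZl -!fE bl.
- move=> x; have [->|x0] := eqVneq (nm (f x)) 0.
    have /(le_trans (nm_ge0 _)) := bb x (f x).
    have [x0|x0] := eqVneq (nm x) 0; first by rewrite x0 mulr0.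
    have xp : 0 < nm x by rewrite lt_neqAle eq_sym x0 nm_ge0.
    have /(le_trans (nm_ge0 _)) := bb x x.
    by rewrite pmulr_lge0.
  have fp : 0 < nm (f x) by rewrite lt_neqAle eq_sym x0 nm_ge0.
  have := bb x (f x); rewrite fE ip_nm nm_real ?sqr_ge0 // expr2.
  by rewrite ler_pM2r.
by exists T => // x y; rewrite TE fE.
Qed.

(** Applying [bounded_form_op] to (x, y) |-> <x, T y> produces an adjoint, so
    the choice made in [adj] succeeds. *)
Lemma adjE T x y : ip (T x) y = ip x (adj T y).
Proof.
have [r r0 bT] := bop_bdd T.
have [|||S _ SE] := @bounded_form_op (fun x y => ip x (T y)) r.
- by move=> c u u' v; rewrite ipDl ipZl.
- by move=> c u v v'; rewrite bop_linear ipDr ipZr.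
- move=> u v; apply: le_trans (cauchy_schwarz _ _) _.
  by rewrite -mulrA mulrCA ler_wpM2l ?nm_ge0.
have ex : exists S : bop H, [set S : bop H | forall x y, ip (T x) y = ip x (S y)] S.
  by exists S => u v; rewrite ipC (ipC (S v)) SE.
exact: (xgetPex 0 ex).
Qed.

Lemma adjEr T x y : ip x (T y) = ip (adj T x) y.
Proof. by rewrite ipC adjE -ipC. Qed.

Lemma bop_ip_inj S T : (forall x y, ip (S x) y = ip (T x) y) -> S = T.
Proof. by move=> ST; apply: bopE => x; apply: ip_inj => y. Qed.

Lemma adjK T : adj (adj T) = T.
Proof. by apply: bop_ip_inj => x y; rewrite -adjEr adjE. Qed.
Lemma adjM S T : adj (S * T) = adj T * adj S.
Proof. by apply: bop_ip_inj => x y; rewrite bop_mulE -!adjEr. Qed.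
Lemma adjD S T : adj (S + T) = adj S + adj T.
Proof. by apply: bop_ip_inj => x y; rewrite bop_addE ipDl -!adjEr bop_addE ipDr. Qed.
Lemma adjZ c T : adj (c *: T) = c^* *: adj T.
Proof. by apply: bop_ip_inj => x y; rewrite bop_scaleE ipZl -!adjEr bop_scaleE ipZr. Qed.
Lemma adj1 : adj 1 = 1 :> bop H.
Proof. by apply: bop_ip_inj => x y; rewrite -adjEr. Qed.
Lemma adj0 : adj 0 = 0 :> bop H.
Proof. by apply: bop_ip_inj => x y; rewrite -adjEr ip0r bop_0E ip0l. Qed.
Lemma adjN T : adj (- T) = - adj T.
Proof. by apply: bop_ip_inj => x y; rewrite bop_oppE ipNl -!adjEr bop_oppE ipNr. Qed.
Lemma adjB S T : adj (S - T) = adj S - adj T.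
Proof. by rewrite adjD adjN. Qed.
Lemma adjX T n : adj (T ^+ n) = adj T ^+ n.
Proof. by elim: n => [|n IH]; rewrite ?expr0 ?adj1 // exprS adjM IH -exprSr. Qed.
Lemma nm_adj T x : nm (T x) ^+ 2 = nm (ip (adj T (T x)) x).
Proof. by rewrite -adjEr ip_nm nm_real // sqr_ge0. Qed.

Lemma bdd_adj r T : 0 <= r -> bdd r T -> bdd r (adj T).
Proof.
move=> r0 bT x.
have [->|x0] := eqVneq (nm (adj T x)) 0; first by rewrite mulr_ge0 ?nm_ge0.
have xp : 0 < nm (adj T x) by rewrite lt_neqAle eq_sym x0 nm_ge0.
rewrite -(ler_pM2r xp) -expr2 nm_adj adjK.
apply: le_trans (cauchy_schwarz _ _) _; rewrite mulrAC ler_wpM2r ?nm_ge0 //.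
Qed.

Lemma adjT_eq0 T : adj T * T = 0 -> T = 0.
Proof.
move=> TT; apply: bopE => x; apply: nm0_eq0; apply/eqP.
by rewrite -sqrf_eq0 nm_adj -bop_mulE TT ip0l nm0.
Qed.

End Operators.

Arguments bdd_le {R H r r' T} _ _.
Arguments bdd0 {R H}.
Arguments bdd1 {R H}.
Arguments bddD {R H r r' S T} _ _.
Arguments bddM {R H r r' S T} _ _ _.
Arguments bddZ {R H} c {r T} _.
Arguments bddN {R H r T} _.
Arguments bdd_adj {R H r T} _ _.

(** * The weak-* topology *)

Section WeakStar.
Variables (R : realType) (H : hilbertType R).
Implicit Types (x y z : H) (S T U : bop H) (r : R) (c : R[i]).
Local Notation ip := (inner H).

Local Notation nf := (@normal_functional R H : bop H -> {ptws l2seq H * l2seq H -> R[i]^o}).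

(** The topology is initial for the family of all normal functionals. *)
Lemma bop_cvgP (I : Type) (F : set_system I) {FF : Filter F} (f : I -> bop H) T :
  f @ F --> T <->
  forall xe, (fun i => normal_functional (f i) xe) @ F --> normal_functional T xe.
Proof.
split=> [fT xe|fT A].
  have cT : nf @ T --> nf T.
    exact: (@initial_continuous _ _ nf T).
  have nT : (nf \o f) @ F --> nf T.
    exact: cvg_comp fT cT.
  have /cvg_sup/(_ xe) nTx := nT.
  move=> B; rewrite nbhsE => -[C [oC CT] CB].
  apply: (filterS (fun i => CB (nf (f i) xe))).
  apply: (nTx [set g | C (g xe)]); apply: open_nbhs_nbhs; split => //.
  by exists C.
have nT : (nf \o f) @ F --> nf T.
  apply/cvg_sup => xe B [C [[D oD <-] DT] CB].
  have : nbhs (normal_functional T xe) D by apply: open_nbhs_nbhs; split.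
  by move=> /(fT xe); exact: (filterS (fun i => CB (nf (f i)))).
move=> [B [[C oC <-] CT] BA].
have : nbhs (nf T) C by apply: open_nbhs_nbhs; split.
by move=> /nT; exact: (filterS (fun i => BA (f i))).
Qed.

Definition l2terms (T : bop H) (xe : l2seq H * l2seq H) n : R[i]^o :=
  ip (T (xe.1 n)) (xe.2 n).

Definition l2mass (xe : l2seq H * l2seq H) n : R^o :=
  nm (xe.1 n) ^+ 2 + nm (xe.2 n) ^+ 2.

Lemma l2_cvg (xi : l2seq H) : cvgn (series (fun n => nm (xi n) ^+ 2 : R^o)).
Proof.
have /cvg_ex[l xl] := @l2seqP _ _ xi.
apply/cvg_ex; exists (complex.Re l); apply/cvgrPdist_lt => e e0.
move/cvg_nmP : xl => /(_ e e0); apply: filterS => n.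
have -> : series (fun n => `|xi n| ^+ 2) n = (series (fun n => nm (xi n) ^+ 2) n)%:C%C :> R[i].
  rewrite /series /= (big_morph _ (@realcD R) (erefl _)).
  by apply: eq_bigr => i _; rewrite nmE -rmorphXn.
apply: le_lt_trans.
by apply: le_trans (Re_le_nm _); case: l.
Qed.

Lemma l2mass_cvg xe : cvgn (series (l2mass xe)).
Proof. by apply: is_cvg_seriesD; exact: l2_cvg. Qed.

Lemma l2terms_le r T xe n : 0 <= r -> bdd r T -> nm (l2terms T xe n) <= r * l2mass xe n.
Proof.
move=> r0 bT; apply: le_trans (cauchy_schwarz _ _) _.
apply: le_trans (ler_wpM2r (nm_ge0 _) (bT _)) _.
rewrite -mulrA ler_wpM2l // /l2mass.
move: (nm_ge0 (xe.1 n)) (nm_ge0 (xe.2 n)); move: (nm (xe.1 n)) (nm (xe.2 n)) => a b a0 b0.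
nra.
Qed.

Lemma series_scale_cvg (u : nat -> R^o) (r : R) :
  cvgn (series u) -> cvgn (series (fun n => r * u n : R^o)).
Proof.
move=> /cvg_ex[l ul]; apply/cvg_ex; exists (r * l).
have -> : series (fun n => r * u n : R^o) = (fun n => r * series u n).
  by apply/funext => n; rewrite /series /= mulr_sumr.
by apply: cvgM => //; exact: cvg_cst.
Qed.

Lemma l2terms_cvg T xe : cvgn (series (l2terms T xe)).
Proof.
have [r r0 bT] := bop_bdd T.
apply/cvg_ex/complex_series_cvg.
have cm : cvgn (series (fun n => r * l2mass xe n : R^o)).
  exact: (@series_scale_cvg _ r (@l2mass_cvg xe)).
suff /cvg_ex : cvgn (series (fun n => nm (l2terms T xe n) : R^o)) by [].
apply: (series_le_cvg _ _ _ cm) => n.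
- exact: nm_ge0.
- by rewrite mulr_ge0 // addr_ge0 // sqr_ge0.
- exact: l2terms_le.
Qed.

Lemma normal_functional_cvg T xe : series (l2terms T xe) @ \oo --> normal_functional T xe.
Proof. exact: l2terms_cvg. Qed.

Lemma normal_functional_unique T xe (l : R[i]^o) : series (l2terms T xe) @ \oo --> l ->
  normal_functional T xe = l.
Proof. by move=> sl; apply: cvg_lim. Qed.

Lemma cvg_nm_le (I : Type) (F : set_system I) {FF : ProperFilter F}
  (f : I -> R[i]^o) (l : R[i]^o) r :
  f @ F --> l -> (\forall i \near F, nm (f i) <= r) -> nm l <= r.
Proof.
move=> /cvg_nmP fl fr; apply/ler_addgt0Pr => e e0.
have [i [fi li]] := filter_ex (filterI fr (fl _ e0)).
have := nm_triangle (f i) (l - f i); rewrite (addrC (f i)) subrK => /le_trans; apply.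
by apply: lerD => //; exact: ltW.
Qed.

(** The tail of the series defining a normal functional is small uniformly on
    bounded sets of operators.  This is why on such sets the weak operator
    topology and the weak-* topology coincide. *)
Lemma normal_tail r xe (e : R) : 0 <= r -> 0 < e -> exists N, forall T, bdd r T ->
  nm (normal_functional T xe - series (l2terms T xe) N) <= e.
Proof.
move=> r0 e0.
have e'0 : 0 < e / (r + 1) by rewrite divr_gt0 // ltr_wpDl.
have /cvg_ex[l ml] := @l2mass_cvg xe.
have nd : {homo series (l2mass xe) : n m / (n <= m)%N >-> n <= m}.
  by apply: nondecreasing_series => n _ _; rewrite addr_ge0 // sqr_ge0.
have lb n : series (l2mass xe) n <= l.
  by have := nondecreasing_cvgn_le nd (cvgP _ ml) n; rewrite (cvg_lim _ ml).
move/cvgrPdist_lt : (ml) => /(_ _ e'0) [N _ /(_ N (leqnn _)) /= lN].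
exists N => T bT.
apply: (@cvg_nm_le nat \oo _ (fun n => series (l2terms T xe) n - series (l2terms T xe) N)).
  by apply: cvgB; [exact: normal_functional_cvg|exact: cvg_cst].
exists N => // m /= Nm; rewrite sub_series_geq //.
apply: (@le_trans _ _ (r * (series (l2mass xe) m - series (l2mass xe) N))).
  rewrite sub_series_geq // mulr_sumr.
  elim/big_ind2 : _ => [|a b c d ab cd|i _]; first by rewrite nm0.
    by apply: le_trans (nm_triangle _ _) _; exact: lerD.
  exact: l2terms_le.
apply: (@le_trans _ _ (r * (e / (r + 1)))).
  rewrite ler_wpM2l //; apply: (@le_trans _ _ (l - series (l2mass xe) N)).
    by rewrite lerD2r.
  by apply: ltW; apply: le_lt_trans lN; exact: ler_norm.
by rewrite mulrCA ler_piMr ?ltW // ltr_pdivrMr ?ltr_wpDl // mul1r ltrDl.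
Qed.

Lemma bdd_wot_cvg (I : Type) (F : set_system I) {FF : Filter F}
    (f : I -> bop H) T r :
  0 <= r -> (\forall i \near F, bdd r (f i)) -> bdd r T ->
  (forall x y, ((fun i => ip (f i x) y) : I -> R[i]^o) @ F --> (ip (T x) y : R[i]^o)) ->
  f @ F --> T.
Proof.
move=> r0 fr bT fT; apply/bop_cvgP => xe; apply/cvg_nmP => e e0.
have e30 : 0 < e / 3 by rewrite divr_gt0.
have [N NT] := normal_tail xe r0 e30.
have : ((fun i => series (l2terms (f i) xe) N) : I -> R[i]^o) @ F --> series (l2terms T xe) N.
  elim: N {NT} => [|N IH].
    have s0 U : series (l2terms U xe) 0 = 0 by rewrite /series /= big_geq.
    by rewrite s0; under eq_fun do rewrite s0; exact: cvg_cst.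
  have sS U : series (l2terms U xe) N.+1 = series (l2terms U xe) N + l2terms U xe N.
    by rewrite /series /= big_nat_recr.
  rewrite sS; under eq_fun do rewrite sS.
  by apply: cvgD IH _; exact: fT.
move=> /cvg_nmP /(_ _ e30); apply: filterS2 fr => i bi sTi.
have := NT _ bT; have := NT _ bi; rewrite nmBC => h1 h2.
set a := normal_functional T xe in h2 *; set b := normal_functional _ xe in h1 *.
set a' := series _ _ in h2 sTi; set b' := series (l2terms (f i) xe) N in h1 sTi.
have -> : a - b = (a - a') + (a' - b') + (b' - b) by rewrite !addrA !subrK.
apply: le_lt_trans (nm_triangle _ _) _.
have := nm_triangle (a - a') (a' - b'); lra.
Qed.

Lemma wot_cvg (I : Type) (F : set_system I) {FF : Filter F} (f : I -> bop H) T :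
  f @ F --> T ->
  forall x y, ((fun i => ip (f i x) y) : I -> R[i]^o) @ F --> (ip (T x) y : R[i]^o).
Proof.
move=> /bop_cvgP fT x y.
(* A matrix coefficient is the normal functional of sequences with one term. *)
have sq (u : H) : square_summable (fun n : nat => if n is 0 then u else 0).
  apply/cvg_ex; exists (`|u| ^+ 2); apply: cvg_near_cst; exists 1%N => // -[//|n] _.
  rewrite /series /= big_nat_recl //= big1 ?addr0 // => i _.
  by rewrite normr0 expr0n.
have nf S : normal_functional S (L2seq (sq x), L2seq (sq y)) = ip (S x) y.
  apply: normal_functional_unique; apply: cvg_near_cst; exists 1%N => // -[//|n] _.
  rewrite /series /= big_nat_recl //= big1 ?addr0 // => i _.
  by rewrite /l2terms /= ip0r.
have := fT (L2seq (sq x), L2seq (sq y)); rewrite nf.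
by under eq_fun do rewrite nf.
Qed.

Lemma bop_cvg_unique (I : Type) (F : set_system I) {FF : ProperFilter F}
    (f : I -> bop H) S T :
  f @ F --> S -> f @ F --> T -> S = T.
Proof.
move=> /wot_cvg fS /wot_cvg fT; apply: bop_ip_inj => x y.
exact: normed_cvg_unique (fS x y) (fT x y).
Qed.

Lemma l2_image (xi : l2seq H) T : square_summable (T \o xi).
Proof.
have [r r0 bT] := bop_bdd T.
apply/cvg_ex.
have := @complex_series_cvg R (fun n => `|(T \o xi) n| ^+ 2); apply.
have cm : cvgn (series (fun n => r ^+ 2 * nm (xi n) ^+ 2 : R^o)).
  exact: (@series_scale_cvg _ (r ^+ 2) (@l2_cvg xi)).
suff /cvg_ex : cvgn (series (fun n => nm (`|(T \o xi) n| ^+ 2) : R^o)) by [].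
apply: (series_le_cvg _ _ _ cm) => n.
- exact: nm_ge0.
- by rewrite mulr_ge0 // sqr_ge0.
- rewrite nmE -[X in nm X](rmorphXn (real_complex R)) nm_real ?sqr_ge0 //= -exprMn.
  by rewrite lerXn2r ?nnegrE ?nm_ge0 ?mulr_ge0 ?nm_ge0.
Qed.

(** T |-> S T U is weak-* continuous: normal functionals absorb U and the
    adjoint of S into their sequences. *)
Lemma bop_cvgM (I : Type) (F : set_system I) {FF : Filter F} (f : I -> bop H) S T U :
  f @ F --> T -> (fun i => S * f i * U) @ F --> S * T * U.
Proof.
move=> /bop_cvgP fT; apply/bop_cvgP => -[xi eta].
have nf V : normal_functional (S * V * U) (xi, eta) =
    normal_functional V (L2seq (@l2_image xi U), L2seq (@l2_image eta (adj S))).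
  apply: normal_functional_unique.
  have -> : l2terms (S * V * U) (xi, eta) =
      l2terms V (L2seq (@l2_image xi U), L2seq (@l2_image eta (adj S))).
    by apply/funext => n; rewrite /l2terms /= -adjE.
  exact: normal_functional_cvg.
by rewrite nf; under eq_fun do rewrite nf; exact: fT.
Qed.

Lemma bop_cvgMl (I : Type) (F : set_system I) {FF : Filter F} (f : I -> bop H) S T :
  f @ F --> T -> (fun i => S * f i) @ F --> S * T.
Proof.
by move=> /(@bop_cvgM _ _ _ _ S _ 1); rewrite mulr1; under eq_fun do rewrite mulr1.
Qed.

Lemma bop_cvgMr (I : Type) (F : set_system I) {FF : Filter F} (f : I -> bop H) T U :
  f @ F --> T -> (fun i => f i * U) @ F --> T * U.
Proof.
by move=> /(@bop_cvgM _ _ _ _ 1 _ U); rewrite mul1r; under eq_fun do rewrite mul1r.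
Qed.

Lemma bop_cvgB (I : Type) (F : set_system I) {FF : Filter F} (f g : I -> bop H) S T :
  f @ F --> S -> g @ F --> T -> (fun i => f i - g i) @ F --> S - T.
Proof.
move=> /bop_cvgP fS /bop_cvgP gT; apply/bop_cvgP => xe.
have nf U V : normal_functional (U - V) xe = normal_functional U xe - normal_functional V xe.
  rewrite /normal_functional -lim_seriesB; [|exact: l2terms_cvg..].
  congr (limn (series _)); apply/funext => n; exact: ipBl.
by rewrite nf; under eq_fun do rewrite nf; exact: cvgB.
Qed.

Lemma bdd_form r T : (forall x y, nm (ip (T x) y) <= r * nm x * nm y) -> bdd r T.
Proof.
move=> h x; have := h x (T x); rewrite ip_nm nm_real ?sqr_ge0 // => hx.
have [Tx|Tx] := eqVneq (nm (T x)) 0; last first.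
  by rewrite -(@ler_pM2r _ (nm (T x))) // lt_neqAle eq_sym Tx nm_ge0.
rewrite Tx; have := h x x; have := nm_ge0 (ip (T x) x); have := nm_ge0 x.
have [->|x0] := eqVneq (nm x) 0; first by rewrite !mulr0.
move=> x1 a b; have := le_trans a b; rewrite pmulr_lge0 //.
by rewrite lt_neqAle eq_sym x0.
Qed.

Lemma bdd_cvg (I : Type) (F : set_system I) {FF : ProperFilter F}
    (f : I -> bop H) T r :
  f @ F --> T -> (\forall i \near F, bdd r (f i)) -> bdd r T.
Proof.
move=> /wot_cvg fT fr; apply: bdd_form => x y.
apply: cvg_nm_le (fT x y) _; apply: filterS fr => i bi.
by apply: le_trans (cauchy_schwarz _ _) _; rewrite ler_wpM2r ?nm_ge0.
Qed.

Lemma selfadj_cvg (I : Type) (F : set_system I) {FF : ProperFilter F}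
    (f : I -> bop H) T :
  f @ F --> T -> (\forall i \near F, adj (f i) = f i) -> adj T = T.
Proof.
move=> /wot_cvg fT fa; apply: bop_ip_inj => x y; rewrite -adjEr.
apply: (@normed_cvg_unique _ _ _ _ _ (fun i => ip (f i x) y : R[i]^o) _ _ _ (fT x y)).
have /cvg_nmP fyx := fT y x.
apply/cvg_nmP => e e0; apply: filterS2 fa (fyx _ e0) => i fi.
by rewrite -nm_conj rmorphB /= -!ipC (adjEr (f i) x y) fi.
Qed.

(** Weak-* compactness of balls, stated for ultrafilters: the limits of the
    matrix coefficients exist by compactness of discs and form a bounded
    sesquilinear form, which represents the limit operator. *)
Lemma bdd_ultra_cvg (I : Type) (F : set_system I) {FU : UltraFilter F}
    (f : I -> bop H) r :
  0 <= r -> (\forall i \near F, bdd r (f i)) -> exists2 T, bdd r T & f @ F --> T.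
Proof.
move=> r0 fr.
have fb x y : \forall i \near F, nm (ip (f i x) y) <= r * nm x * nm y.
  apply: filterS fr => i bi.
  by apply: le_trans (cauchy_schwarz _ _) _; rewrite ler_wpM2r ?nm_ge0.
have [b bE] : exists b : H -> H -> R[i]^o, forall x y,
   ((fun i => ip (f i x) y) : I -> R[i]^o) @ F --> b x y.
  have W (p : H * H) : exists l : R[i]^o, ((fun i => ip (f i p.1) p.2) : I -> R[i]^o) @ F --> l.
    exact: ultra_cvg_complex (fb p.1 p.2).
  have [b bE] := choice W; exists (fun x y => b (x, y)) => x y; exact: (bE (x, y)).
have [|||T bT TE] := @bounded_form_op _ H b r.
- move=> c x x' y; apply: normed_cvg_unique (bE (c *: x + x') y) _.
  under eq_fun do rewrite bop_linear ipDl ipZl.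
  by apply: cvgD; [apply: cvgM; [exact: cvg_cst|exact: bE]|exact: bE].
- move=> c x y y'; apply: normed_cvg_unique (bE x (c *: y + y')) _.
  under eq_fun do rewrite ipDr ipZr.
  by apply: cvgD; [apply: cvgM; [exact: cvg_cst|exact: bE]|exact: bE].
- by move=> x y; apply: cvg_nm_le (bE x y) (fb x y).
exists T => //; apply: (bdd_wot_cvg r0 fr bT) => x y; rewrite TE; exact: bE.
Qed.

(** A bounded family in which any finitely many of the equations Phi g S = 0 can
    be solved approximately has a weak-* limit solving all of them.  This serves
    twice: for operators that commute with many unitaries, and for the unit of
    an ideal. *)
Lemma approximate_solutions_limit (G C : set (bop H))
    (Phi : bop H -> bop H -> bop H) r :
  0 <= r -> (forall S, C S -> bdd r S) ->
  (forall (gs : seq (bop H)) (eps : R), (forall g, g \in gs -> G g) -> 0 < eps ->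
     exists S, C S /\ forall g, g \in gs -> bdd eps (Phi g S)) ->
  (forall g (F : set_system (bop H)) T, ProperFilter F -> F --> T ->
     Phi g @ F --> Phi g T) ->
  exists (F : set_system (bop H)) (T : bop H),
    [/\ ProperFilter F, F C, F --> T & forall g, G g -> Phi g T = 0].
Proof.
move=> r0 Cb approx cPhi.
pose A (p : seq (bop H) * R) := [set S | C S /\
  forall g, g \in p.1 -> bdd p.2 (Phi g S)].
pose P := [set p : seq (bop H) * R | (forall g, g \in p.1 -> G g) /\ 0 < p.2].
have FA : ProperFilter (filter_from P A).
  apply: filter_from_proper; last by move=> [gs eps] [/= Ggs e0]; exact: approx.
  apply: filter_from_filter; first by exists ([::], 1); split => //=.
  move=> [gs1 e1] [gs2 e2] [/= G1 p1] [/= G2 p2].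
  exists (gs1 ++ gs2, Num.min e1 e2); first split => /=.
  - by move=> g; rewrite mem_cat => /orP[/G1|/G2].
  - by rewrite lt_min p1.
  move=> S [CS Sg]; split; split => //= g gg.
  - by apply: bdd_le _ (Sg g _); rewrite ?ge_min ?lexx //= mem_cat gg.
  - by apply: bdd_le _ (Sg g _); rewrite ?ge_min ?lexx ?orbT //= mem_cat gg orbT.
have [F [FU AF]] := ultraFilterLemma FA.
have AP p : P p -> F (A p) by move=> Pp; apply: AF; exists p.
have FC : F C.
  have : F (A ([::], 1)) by apply: AP; split => //=.
  by apply: filterS => S [].
have [||T _ FT] := @bdd_ultra_cvg (bop H) F FU id r; first by [].
  by apply: filterS FC => S; exact: Cb.
have PF : ProperFilter F by exact: ultra_proper.
exists F, T; split => // g Gg; apply: bdd_nearly0 => eps eps0.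
apply: (@bdd_cvg _ F _ (Phi g) _ _ (cPhi g F T PF FT)).
have : F (A ([:: g], eps)) by apply: AP; split => //= u; rewrite inE => /eqP ->.
by apply: filterS => S [_]; apply; rewrite mem_head.
Qed.

End WeakStar.

Arguments bop_cvgM {R H I F FF f} S {T} U _.
Arguments bop_cvgMl {R H I F FF f} S {T} _.
Arguments bop_cvgMr {R H I F FF f T} U _.
Arguments bop_cvgB {R H I F FF f g S T} _ _.
Arguments bdd_cvg {R H I F FF f T r} _ _.

(** * Von Neumann algebras and their unitaries *)

Section VonNeumann.
Variables (R : realType) (H : hilbertType R).
Implicit Types (x y z : H) (S T U : bop H) (r : R) (c : R[i]).

Section Closure.
Variable M : set (bop H).
Hypothesis vM : von_neumann M.

Lemma vnP T : (forall S, commutant M S -> T * S = S * T) -> M T.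
Proof. by move=> h; rewrite -(proj2 vM). Qed.

Lemma vn_comm T S : M T -> commutant M S -> T * S = S * T.
Proof. by move=> MT cS; rewrite cS. Qed.

Lemma vn_adj T : M T -> M (adj T). Proof. exact: (proj1 vM). Qed.

Lemma vn1 : M 1.
Proof. by apply: vnP => S _; rewrite mul1r mulr1. Qed.

Lemma vn0 : M 0.
Proof. by apply: vnP => S _; rewrite mul0r mulr0. Qed.

Lemma vnD S T : M S -> M T -> M (S + T).
Proof. by move=> MS MT; apply: vnP => U cU; rewrite mulrDl mulrDr !(vn_comm _ cU). Qed.

Lemma vnN T : M T -> M (- T).
Proof. by move=> MT; apply: vnP => U cU; rewrite mulNr mulrN !(vn_comm _ cU). Qed.

Lemma vnB S T : M S -> M T -> M (S - T).
Proof. by move=> MS MT; apply: vnD => //; exact: vnN. Qed.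

Lemma vnZ c T : M T -> M (c *: T).
Proof.
by move=> MT; apply: vnP => U cU; rewrite -bop_scaleAl -bop_scaleAr (vn_comm _ cU).
Qed.

Lemma vnM S T : M S -> M T -> M (S * T).
Proof.
move=> MS MT; apply: vnP => U cU.
by rewrite -mulrA (vn_comm MT cU) mulrA (vn_comm MS cU) mulrA.
Qed.

Lemma vnX T n : M T -> M (T ^+ n).
Proof. by move=> MT; elim: n => [|n IH]; [exact: vn1|rewrite exprS; exact: vnM]. Qed.

Lemma vn_sum n (f : 'I_n -> bop H) : (forall i, M (f i)) -> M (\sum_(i < n) f i).
Proof. by move=> Mf; elim/big_ind: _ => //; [exact: vn0|exact: vnD]. Qed.

Lemma vn_cvg (I : Type) (F : set_system I) {FF : ProperFilter F} (f : I -> bop H) T :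
  f @ F --> T -> (\forall i \near F, M (f i)) -> M T.
Proof.
move=> fT Mf; apply: vnP => S cS.
apply: (bop_cvg_unique (bop_cvgMr S fT)).
apply: cvg_trans (bop_cvgMl S fT); apply: near_eq_cvg.
by apply: filterS Mf => i Mi; rewrite /= (vn_comm Mi cS).
Qed.

End Closure.

Definition unitary U := adj U * U = 1 /\ U * adj U = 1.

(** The operator b = 1 - sqrt (1 - h^2) is the fixed point of
    b |-> (h^2 + b^2) / 2.  On the ball of radius 1/2 this map is a contraction
    of ratio 1/2. *)
Section SquareRoot.
Variable h : bop H.
Hypotheses (hh : adj h = h) (bh : bdd 2^-1 h).

Fixpoint sqrt_iter n : bop H :=
  if n is m.+1 then 2^-1 *: (h * h + sqrt_iter m * sqrt_iter m) else 0.

Let half (T : bop H) : T = 2^-1 *: (T + T).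
Proof.
apply: bopE => x; rewrite bop_scaleE bop_addE scalerDr -scalerDl.
by rewrite (_ : 2^-1 + 2^-1 = 1) ?scale1r //; field.
Qed.

Let nm_half : nm (2^-1 : R[i]) = 2^-1.
Proof. by rewrite -(realcn R 2) -fmorphV nm_real // invr_ge0. Qed.

Lemma sqrt_iter_bdd n : bdd 2^-1 (sqrt_iter n).
Proof.
elim: n => [|n IH]; first by apply: bdd_le _ bdd0; rewrite invr_ge0.
have h0 : 0 <= 2^-1 :> R by rewrite invr_ge0.
have := bddZ 2^-1 (bddD (bddM h0 bh bh) (bddM h0 IH IH)).
by rewrite nm_half; apply: bdd_le; lra.
Qed.

Arguments sqrt_iter_bdd : clear implicits.

Lemma sqrt_iter_selfadj n : adj (sqrt_iter n) = sqrt_iter n.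
Proof.
elim: n => [|n IH] /=; first exact: adj0.
by rewrite adjZ adjD !adjM IH hh fmorphV rmorph_nat.
Qed.

Lemma sqrt_iter_comm n : h * sqrt_iter n = sqrt_iter n * h.
Proof.
elim: n => [|n IH] /=; first by rewrite mulr0 mul0r.
by rewrite -bop_scaleAl -bop_scaleAr mulrDl mulrDr mulrA -!mulrA -IH !mulrA IH.
Qed.

Lemma sqrt_iter_vn N n : von_neumann N -> N h -> N (sqrt_iter n).
Proof.
move=> vN Nh; elim: n => [|n IH] /=; first exact: vn0.
by apply: vnZ => //; apply: vnD => //; apply: vnM.
Qed.

Lemma sqr_diff_bdd (S T : bop H) r : 0 <= r -> bdd 2^-1 S -> bdd 2^-1 T ->
  bdd r (S - T) -> bdd r (S * S - T * T).
Proof.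
move=> r0 bS bT bST.
have -> : S * S - T * T = (S - T) * S + T * (S - T).
  by rewrite mulrBl mulrBr addrA subrK.
have h0 : 0 <= 2^-1 :> R by rewrite invr_ge0.
by apply: bdd_le _ (bddD (bddM r0 bST bS) (bddM h0 bT bST)); lra.
Qed.

Arguments sqr_diff_bdd {S T r} _ _ _ _.

Lemma sqrt_iter_step n : bdd (2^-1 ^+ n) (sqrt_iter n.+1 - sqrt_iter n).
Proof.
elim: n => [|n IH].
  rewrite expr0 /= subr0; apply: bdd_le _ (sqrt_iter_bdd 1).
  by rewrite invf_le1 // ler1n.
have -> : sqrt_iter n.+2 - sqrt_iter n.+1 =
    2^-1 *: (sqrt_iter n.+1 * sqrt_iter n.+1 - sqrt_iter n * sqrt_iter n).
  by rewrite /= -scalerBr opprD addrACA subrr add0r.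
rewrite exprS -[X in X * _]nm_half.
apply: bddZ; apply: (sqr_diff_bdd _ (sqrt_iter_bdd n.+1) (sqrt_iter_bdd n) IH).
exact: exprn_ge0.
Qed.

Lemma sqrt_iter_cauchy n m :
  bdd (2 * 2^-1 ^+ n) (sqrt_iter (n + m) - sqrt_iter n).
Proof.
suff : bdd (2 * 2^-1 ^+ n - 2 * 2^-1 ^+ (n + m)) (sqrt_iter (n + m) - sqrt_iter n).
  by apply: bdd_le; rewrite gerBl mulr_ge0 // exprn_ge0.
elim: m => [|m IH]; first by rewrite addn0 !subrr; exact: bdd0.
rewrite addnS.
have -> : sqrt_iter (n + m).+1 - sqrt_iter n =
  (sqrt_iter (n + m).+1 - sqrt_iter (n + m)) + (sqrt_iter (n + m) - sqrt_iter n).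
  by rewrite addrA subrK.
apply: bdd_le _ (bddD (sqrt_iter_step (n + m)) IH).
rewrite (exprS _ (n + m)); move: (2^-1 ^+ (n + m)) (2^-1 ^+ n) => a b; lra.
Qed.

Lemma small_half_pow (e : R) : 0 < e -> exists n, 2 * 2^-1 ^+ n <= e.
Proof.
move=> e0.
have : (fun n => geometric 2 (2^-1) n) @ \oo --> (0 : R^o).
  by apply: cvg_geometric; rewrite gtr0_norm ?invr_gt0 // invf_lt1 // ltr1n.
move=> /cvgrPdist_lt /(_ _ e0) [n _ /(_ n (leqnn _))] /=.
rewrite sub0r normrN => hn; exists n; apply: ltW; apply: le_lt_trans hn.
by rewrite /geometric /=; exact: ler_norm.
Qed.

(** The iterates are polynomials in h, so their limit inherits self-adjointness,
    commutation with h, and membership in every von Neumann algebra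
    containing h. *)
Lemma sqrt_one_minus_sqr : exists k : bop H,
  [/\ adj k = k, k * k = 1 - h * h, h * k = k * h
    & forall N, von_neumann N -> N h -> N k].
Proof.
have h0 : 0 <= 2^-1 :> R by rewrite invr_ge0.
have [F [FU Foo]] := @ultraFilterLemma nat \oo _.
have [|b bb itb] := @bdd_ultra_cvg R H nat F FU sqrt_iter 2^-1 h0.
  by apply: filterE; exact: sqrt_iter_bdd.
have bn n : bdd (2 * 2^-1 ^+ n) (b - sqrt_iter n).
  apply: (@bdd_cvg _ _ _ F _ (fun m => sqrt_iter m - sqrt_iter n)).
    by apply: bop_cvgB => //; exact: cvg_cst.
  apply: Foo; exists n => // m /= nm; rewrite -(subnKC nm); exact: sqrt_iter_cauchy.
(* The iterates converge in norm, so b is a fixed point up to any error. *)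
have fixb : b = 2^-1 *: (h * h + b * b).
  apply/eqP; rewrite -subr_eq0; apply/eqP/bdd_nearly0 => e e0.
  have [n ne] := small_half_pow e0.
  have -> : b - 2^-1 *: (h * h + b * b) = (b - sqrt_iter n.+1) +
     2^-1 *: (sqrt_iter n * sqrt_iter n - b * b).
    rewrite /= -[in RHS]addrA; congr (_ + _); rewrite -!scalerN -scalerDr.
    by congr (_ *: _); rewrite !opprD addrA subrK.
  have n0 : 0 <= 2 * 2^-1 ^+ n :> R by rewrite mulr_ge0 // exprn_ge0.
  have bn' : bdd (2 * 2^-1 ^+ n) (sqrt_iter n - b) by rewrite -opprB; exact/bddN/bn.
  have := bddD (bn n.+1) (bddZ 2^-1 (sqr_diff_bdd n0 (sqrt_iter_bdd n) bb bn')).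
  by apply: bdd_le; rewrite nm_half exprS; move: (2^-1 ^+ n) ne => q; lra.
have adb : adj b = b by apply: (selfadj_cvg itb); apply: filterE => n; exact: sqrt_iter_selfadj.
have cb : h * b = b * h.
  apply: (bop_cvg_unique (bop_cvgMl h itb)).
  have := bop_cvgMr h itb; under eq_fun do rewrite -sqrt_iter_comm.
  exact.
exists (1 - b); split.
- by rewrite adjB adj1 adb.
- have b2 : b + b = h * h + b * b by rewrite {1 2}fixb -scalerDr -half.
  have bb2 : b * b = b + b - h * h by rewrite b2 addrAC subrr add0r.
  have -> : (1 - b) * (1 - b) = 1 - (b + b) + b * b.
    by rewrite mulrBl mul1r mulrBr mulr1 opprB opprD !addrA addrAC.
  by rewrite bb2 addrA subrK.
- by rewrite mulrBr mulrBl mulr1 mul1r cb.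
- move=> N vN Nh; apply: vnB => //; first exact: vn1.
  by apply: (vn_cvg vN itb); apply: filterE => n; exact: sqrt_iter_vn.
Qed.

End SquareRoot.

(** With a = i and b = -i (or conversely), g + i k and g - i k are inverse to
    each other. *)
Lemma mul_scaled_pair (g k : bop H) : g * k = k * g -> k * k = 1 - g * g ->
  forall a b : R[i], a + b = 0 -> a * b = 1 -> (g + a *: k) * (g + b *: k) = 1.
Proof.
move=> gk k2 a b ab0 ab1; rewrite mulrDl !mulrDr -!bop_scaleAl -!bop_scaleAr scalerA.
rewrite ab1 scale1r -gk addrA -[_ + _ + a *: _]addrA -scalerDl (addrC b) ab0.
by rewrite scale0r addr0 k2 addrC subrK.
Qed.

(** After scaling h to a g of norm at most 1/2, g is the mean of the unitaries
    g + i k and g - i k, where k = sqrt (1 - g^2). *)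
Lemma selfadj_unitaries N h : von_neumann N -> N h -> adj h = h ->
  exists (c : R[i]) (u v : bop H),
    [/\ N u /\ N v, unitary u, unitary v & h = c *: u + c *: v].
Proof.
move=> vN Nh hh; have [r r0 bh] := bop_bdd h.
pose s : R := (2 * (r + 1))^-1.
have r1 : 0 < 2 * (r + 1) by rewrite mulr_gt0 // ltr_wpDl.
have s0 : 0 <= s by rewrite invr_ge0 ltW.
pose g := s%:C%C *: h.
have Ng : N g by exact: vnZ.
have gg : adj g = g.
  by rewrite /g adjZ hh; congr (_ *: _); exact: conjc_real.
have bg : bdd 2^-1 g.
  apply: bdd_le _ (bddZ s%:C%C bh); rewrite nm_real // /s.
  by rewrite mulrC ler_pdivrMr // mulrA mulVf ?mul1r ?lerDl // pnatr_eq0.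
have [k [kk k2 gk Nk]] := sqrt_one_minus_sqr gg bg.
have E := mul_scaled_pair gk k2.
have uP (e : R[i]) : e^* = - e -> e * e = -1 -> unitary (g + e *: k).
  move=> ec e2; split; rewrite adjD adjZ gg kk ec E //.
  - by rewrite addNr.
  - by rewrite mulNr e2 opprK.
  - by rewrite subrr.
  - by rewrite mulrN e2 opprK.
exists ((2 * s)^-1)%:C%C, (g + 'i *: k), (g + (- 'i) *: k); split.
- by split; apply: vnD => //; apply: vnZ => //; exact: Nk.
- by apply: uP; [exact: conjCi|rewrite -expr2 sqrCi].
- by apply: uP; [rewrite rmorphN /= conjCi|rewrite mulrNN -expr2 sqrCi].
rewrite -scalerDr scaleNr addrACA subrr addr0 /g -scalerDl scalerA.
rewrite -realcD -realcM (_ : _ * _ = 1) ?scale1r //.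
by rewrite /s; field; rewrite gt_eqF // ltr_wpDl.
Qed.

(** Two unitaries for the real part and two for the imaginary part. *)
Lemma four_unitaries N n : von_neumann N -> N n ->
  exists (c : 'I_4 -> R[i]) (u : 'I_4 -> bop H),
    (forall i, N (u i) /\ unitary (u i)) /\ n = \sum_(i < 4) c i *: u i.
Proof.
move=> vN Nn.
have h2 : (2^-1 : R[i])^* = 2^-1 by rewrite fmorphV rmorph_nat.
have [||c1 [u1 [v1 [[Nu1 Nv1] Uu1 Uv1 e1]]]] := @selfadj_unitaries N (2^-1 *: (n + adj n)) vN.
- by apply: vnZ => //; apply: vnD => //; exact: vn_adj.
- by rewrite adjZ adjD adjK h2 addrC.
have [||c2 [u2 [v2 [[Nu2 Nv2] Uu2 Uv2 e2]]]] := @selfadj_unitaries N ((2^-1 * 'i) *: (adj n - n)) vN.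
- by apply: vnZ => //; apply: vnB => //; exact: vn_adj.
- by rewrite adjZ adjB adjK rmorphM /= h2 conjCi mulrN scaleNr -scalerN opprB.
pose cs := [:: c1; c1; 'i * c2; 'i * c2].
pose us := [:: u1; v1; u2; v2].
exists (fun i => nth 0 cs i), (fun i => nth 0 us i); split.
  by case; do 4?case=> //=.
rewrite !big_ord_recl big_ord0 /= addr0 -!scalerA addrA -e1 -scalerDr -e2 scalerA.
rewrite mulrCA -expr2 sqrCi mulrN1 scaleNr -scalerBr opprB addrACA subrr addr0.
by rewrite scalerDr -scalerDl (_ : 2^-1 + 2^-1 = 1) ?scale1r //; field.
Qed.

End VonNeumann.

(** * Units of weak-* closed ideals *)

Section Ideals.
Variables (R : realType) (H : hilbertType R).
Implicit Types (x y z : H) (S T U : bop H) (r : R) (c : R[i]).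
Local Notation ip := (inner H).

Lemma pos0 : pos_op (0 : bop H).
Proof. by move=> x; rewrite bop_0E ip0l. Qed.

Lemma pos1 : pos_op (1 : bop H).
Proof. by move=> x; rewrite bop_1E ip_nm ler0c sqr_ge0. Qed.

Lemma posD S T : pos_op S -> pos_op T -> pos_op (S + T).
Proof. by move=> pS pT x; rewrite bop_addE ipDl addr_ge0. Qed.

Lemma posZ c T : 0 <= c -> pos_op T -> pos_op (c *: T).
Proof. by move=> c0 pT x; rewrite bop_scaleE ipZl mulr_ge0. Qed.

Lemma pos_conj S T : pos_op T -> pos_op (adj S * T * S).
Proof. by move=> pT x; rewrite !bop_mulE -adjEr. Qed.

Lemma pos_le S T x : pos_op (T - S) -> ip (S x) x <= ip (T x) x.
Proof. by move=> /(_ x); rewrite bop_subE ipBl subr_ge0. Qed.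

Lemma pos_one_sub T : bdd 1 T -> pos_op T -> pos_op (1 - T).
Proof.
move=> bT pT x; rewrite bop_subE ipBl subr_ge0 ip_nm -(ger0_norm (pT x)) nmE lecR.
apply: le_trans (cauchy_schwarz _ _) _; rewrite expr2 ler_wpM2r ?nm_ge0 //.
by have := bT x; rewrite mul1r.
Qed.

(** For positive s and t with s + t = 1, the powers of s decrease and n s^n t is
    at most 1.  The positivity of the products of s and t involved comes from
    writing them as sums of conjugates a^* p a of positive operators p. *)
Section Powers.
Variables s t : bop H.
Hypotheses (ss : adj s = s) (tt : adj t = t) (ps : pos_op s) (pt : pos_op t).
Hypothesis st1 : s = 1 - t.

Let t1 : t = 1 - s.
Proof. by rewrite st1 opprB addrCA subrr addr0. Qed.

Let stC : s * t = t * s.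
Proof. by rewrite t1 mulrBl mulrBr mul1r mulr1. Qed.

Lemma pow_comm n : s ^+ n * t = t * s ^+ n.
Proof. by elim: n => [|n IH]; rewrite ?mul1r ?mulr1 // exprSr -mulrA stC mulrA IH mulrA. Qed.

Lemma pow_diff n : s ^+ n - s ^+ n.+1 = s ^+ n * t.
Proof. by rewrite t1 mulrBr mulr1 exprSr. Qed.

Lemma pow_pos n : pos_op (s ^+ n).
Proof.
elim/ltn_ind: n => -[|[|n]] IH; [exact: pos1|by rewrite expr1|].
by rewrite exprS exprSr mulrA -{1}ss; apply/pos_conj/IH.
Qed.

Lemma pow_mul_pos n : pos_op (s ^+ n * t).
Proof.
elim/ltn_ind: n => -[|[|n]] IH; first by rewrite mul1r.
  have -> : s ^+ 1 * t = adj s * t * s + adj t * s * t.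
    have -> : adj t * s * t = s * t * t by rewrite tt stC.
    have e : s + t = 1 by rewrite st1 subrK.
    by rewrite ss expr1 -mulrDr e mulr1.
  by apply: posD; apply: pos_conj.
have -> : s ^+ n.+2 * t = adj s * (s ^+ n * t) * s.
  by rewrite ss exprS exprSr -!mulrA stC.
exact/pos_conj/IH.
Qed.

Lemma pow_step_pos n : pos_op (s ^+ n * t - s ^+ n.+1 * t).
Proof.
rewrite -mulrBl pow_diff pow_comm -{1}tt.
exact/pos_conj/pow_pos.
Qed.

(** The sum of the s^j t over j < n telescopes to 1 - s^n, and each of its terms
    is at least s^n t. *)
Lemma pow_decay n : pos_op (1 - n%:R *: (s ^+ n * t)).
Proof.
suff : pos_op (1 - s ^+ n - n%:R *: (s ^+ n * t)).
  move=> /posD /(_ (pow_pos n)); by rewrite addrAC subrK.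
elim: n => [|n IH]; first by rewrite expr0 scale0r subr0 subrr; exact: pos0.
have n0 : 0 <= n.+1%:R :> R[i] by rewrite ler0n.
have := posD IH (posZ n0 (pow_step_pos n)).
have nS : n.+1%:R *: (s ^+ n * t) = n%:R *: (s ^+ n * t) + s ^+ n * t.
  by rewrite -natr1 scalerDl scale1r.
by rewrite scalerBr nS !addrA subrK -{1}pow_diff addrA subrK.
Qed.

Lemma pow_contraction n : bdd 1 (s ^+ n).
Proof.
have b1 : bdd 1 s.
  move=> x; rewrite mul1r -ler_sqr ?nnegrE ?nm_ge0 // -lecR -!ip_nm (adjEr s) ss.
  apply: (@pos_le (s * s) 1).
  have -> : 1 - s * s = t + s ^+ 1 * t by rewrite expr1 t1 mulrBr mulr1 addrA subrK.
  by apply: posD => //; exact: pow_mul_pos.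
elim: n => [|n IH]; first exact: bdd1.
by rewrite exprS -(mulr1 1); apply: bddM.
Qed.

End Powers.

Definition sum_sqr (ms : seq (bop H)) : bop H := \sum_(m <- ms) m * adj m.

Lemma sum_sqrE ms x :
  ip (sum_sqr ms x) x = (\sum_(m <- ms) nm (adj m x) ^+ 2)%:C%C.
Proof.
elim: ms => [|m ms IH]; rewrite /sum_sqr ?big_nil ?bop_0E ?ip0l // !big_cons.
by rewrite bop_addE ipDl -/(sum_sqr ms) IH realcD -ip_nm bop_mulE adjE.
Qed.

Lemma sum_sqr_adj ms : adj (sum_sqr ms) = sum_sqr ms.
Proof.
elim: ms => [|m ms IH]; rewrite /sum_sqr ?big_nil ?adj0 // !big_cons.
by rewrite adjD -/(sum_sqr ms) IH adjM adjK.
Qed.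

Section IdealUnit.
Variables N J : set (bop H).
Hypotheses (vN : von_neumann N) (JN : J `<=` N) (J0 : J 0).
Hypothesis JD : forall S T, J S -> J T -> J (S + T).
Hypothesis Jl : forall a m, N a -> J m -> J (a * m).
Hypothesis Jr : forall a m, N a -> J m -> J (m * a).
Hypothesis Jclosed : forall (F : set_system (bop H)) T,
  ProperFilter F -> F --> T -> F J -> J T.

Lemma ideal_sum_sqr ms : (forall m, m \in ms -> J m) -> J (sum_sqr ms).
Proof.
elim: ms => [|m ms IH] Jms; rewrite /sum_sqr ?big_nil // big_cons.
have Jm : J m by apply: Jms; rewrite mem_head.
apply: JD; first by apply: Jr => //; apply: vn_adj => //; exact: JN.
by apply: IH => u ums; apply: Jms; rewrite inE ums orbT.
Qed.

(** Take e = 1 - s^k with s = 1 - h / C, where h is the sum of the m m^* and C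
    exceeds its norm.  A polynomial in h without constant term, e is in J.
    For each m in the list, |m^* s^k x|^2 <= <s^k h s^k x, x>, which by
    [pow_decay] is at most C |x|^2 / 2k. *)
Lemma approximate_unit (ms : seq (bop H)) (eps : R) :
  (forall m, m \in ms -> J m) -> 0 < eps ->
  exists e, [/\ J e, bdd 2 e, adj e = e & forall m, m \in ms -> bdd eps (e * m - m)].
Proof.
move=> Jms eps0; pose h := sum_sqr ms.
have Jh : J h by exact: ideal_sum_sqr.
have [r r0 bh] := bop_bdd h.
pose C := r + 1.
have C0 : 0 < C by rewrite ltr_wpDl.
pose t := (C^-1)%:C%C *: h; pose s := 1 - t.
have C0' : 0 <= (C^-1)%:C%C :> R[i] by rewrite ler0c invr_ge0 ltW.
have tt : adj t = t.
  by rewrite adjZ sum_sqr_adj; congr (_ *: _); exact: conjc_real.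
have ss : adj s = s by rewrite adjB adj1 tt.
have pt : pos_op t.
  apply: posZ => // x; rewrite sum_sqrE ler0c; apply: sumr_ge0 => m _; exact: sqr_ge0.
have bt : bdd 1 t.
  apply: bdd_le _ (bddZ (C^-1)%:C%C bh); rewrite nm_real; last by rewrite invr_ge0 ltW.
  by rewrite ler_pdivrMl // mulr1 lerDl.
have ps : pos_op s by exact: pos_one_sub.
have Jt : J t.
  have -> : t = ((C^-1)%:C%C *: (1 : bop H) : bop H) * h by rewrite -bop_scaleAl mul1r.
  by apply: Jl => //; apply: vnZ => //; exact: vn1.
have Ns : N s by apply: vnB => //; [exact: vn1|exact: JN].
have [k k0 kC] : exists2 k : nat, 0 < k%:R :> R & C / eps ^+ 2 <= k%:R.
  exists (Num.bound (C / eps ^+ 2)).+1; first by rewrite ltr0n.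
  apply: ltW; apply: lt_trans (archi_boundP _) _; last by rewrite ltr_nat.
  by rewrite divr_ge0 ?sqr_ge0 // ltW.
pose e := 1 - s ^+ k.
have ekN m : e * m - m = - (s ^+ k * m) by rewrite mulrBl mul1r addrAC subrr sub0r.
exists e; split.
- rewrite /e; elim: (k) => [|n IH]; first by rewrite expr0 subrr.
  have -> : 1 - s ^+ n.+1 = 1 - s ^+ n + s ^+ n * t.
    by rewrite exprSr /s mulrBr mulr1 opprB addrCA addrC.
  by apply: JD => //; apply: Jl => //; exact: vnX.
- apply: (bdd_le _ (bddD bdd1 (bddN (pow_contraction ss tt ps pt erefl k)))).
  by rewrite -natr1.
- by rewrite adjB adj1 adjX ss.
move=> m mms; rewrite ekN; apply/bddN.
have -> : s ^+ k * m = adj (adj m * s ^+ k) by rewrite adjM adjK adjX ss.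
apply: bdd_adj; first exact: ltW.
have eps_ge0 := ltW eps0.
move=> x; rewrite bop_mulE -ler_sqr ?nnegrE ?mulr_ge0 ?nm_ge0 //.
have := pow_decay ss tt ps erefl (k + k) => /(pos_le x).
rewrite bop_scaleE ipZl exprD -mulrA bop_mulE adjE adjX ss.
rewrite (pow_comm erefl).
rewrite bop_mulE /t bop_scaleE ipZl -/h sum_sqrE bop_1E ip_nm.
rewrite -realcn -!realcM lecR => le.
have {le} : (k + k)%:R * (C^-1 * nm (adj m ((s ^+ k) x)) ^+ 2) <= nm x ^+ 2.
  apply: le_trans le; rewrite ler_wpM2l // ler_wpM2l ?invr_ge0 ?(ltW C0) //.
  rewrite (big_rem m) //= lerDl; apply: sumr_ge0 => u _; exact: sqr_ge0.
move: (nm (adj m _)) => q; rewrite exprMn natrD.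
move: kC; rewrite ler_pdivrMr ?exprn_gt0 // => kC.
rewrite mulrCA -ler_pdivlMl ?invr_gt0 // invrK => qx.
rewrite -(ler_pM2l k0); apply: (@le_trans _ _ (C * nm x ^+ 2)).
  by apply: le_trans qx; rewrite ler_wpM2r ?sqr_ge0 // lerDl ltW.
by rewrite [leRHS]mulrA ler_wpM2r ?sqr_ge0.
Qed.

(** A limit z of self-adjoint approximate left units is in J and is a left unit
    of J.  For a in N, the elements a z and a^* z of J then satisfy z a z = a z
    and z a^* z = a^* z; the adjoint of the second equation is z a z = z a. *)
Lemma ideal_central_unit : exists z : bop H, [/\ J z, adj z = z,
  (forall m, J m -> z * m = m) & (forall a, N a -> z * a = a * z)].
Proof.
have [||||F [z [PF FC Fz zm0]]] := @approximate_solutions_limit R H J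
    [set e | [/\ J e, bdd 2 e & adj e = e]] (fun m e => e * m - m) 2.
- by [].
- by move=> e [].
- move=> ms eps Jms eps0; have [e [Je be ee em]] := approximate_unit Jms eps0.
  by exists e.
- by move=> m F T PF FT; apply: bop_cvgB; [exact: bop_cvgMr|exact: cvg_cst].
have Jz : J z by apply: (Jclosed PF Fz); apply: filterS FC => e [].
have zz : adj z = z by apply: (selfadj_cvg Fz); apply: filterS FC => e [].
have zm m : J m -> z * m = m by move=> /zm0 /subr0_eq.
exists z; split => // a Na.
have az b : N b -> z * (b * z) = b * z by move=> Nb; apply: zm; exact: Jl.
have := congr1 (@adj R H) (az _ (vn_adj vN Na)); rewrite !adjM !adjK zz => <-.
by rewrite -mulrA az.
Qed.

End IdealUnit.

End Ideals.

(** * Averaging over commuting unitaries *)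

Section Averaging.
Variables (R : realType) (H : hilbertType R).
Implicit Types (S T U u v : bop H) (r : R) (c : R[i]).

Lemma unitary_nm u x : unitary u -> nm (u x) = nm x.
Proof.
move=> [uu _]; apply/eqP; rewrite -(eqrXn2 (n := 2)) ?nm_ge0 //; apply/eqP/complexI.
by rewrite -!ip_nm (adjEr u) -bop_mulE uu.
Qed.

Lemma unitary_adj u : unitary u -> unitary (adj u).
Proof. by move=> [u1 u2]; split; rewrite adjK. Qed.

Lemma unitaryM u v : unitary u -> unitary v -> unitary (u * v).
Proof.
move=> [u1 u2] [v1 v2]; split; rewrite adjM -!mulrA.
  by rewrite (mulrA (adj u)) u1 mul1r.
by rewrite (mulrA v) v2 mul1r.
Qed.

Lemma unitaryX u n : unitary u -> unitary (u ^+ n).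
Proof.
move=> Uu; elim: n => [|n IH]; first by split; rewrite adj1 mul1r.
by rewrite exprS; exact: unitaryM.
Qed.

Lemma unitary_conj_bdd u r S : unitary u -> bdd r S -> bdd r (u * S * adj u).
Proof.
move=> Uu bS x; rewrite !bop_mulE unitary_nm // -(unitary_nm x (unitary_adj Uu)).
exact: bS.
Qed.

Definition orbit_mean u n S : bop H :=
  n.+1%:R^-1 *: \sum_(k < n.+1) u ^+ k * S * adj (u ^+ k).

Lemma nm_nat_inv n : nm (n.+1%:R^-1 : R[i]) = n.+1%:R^-1.
Proof. by rewrite -(realcn R) -fmorphV nm_real // invr_ge0. Qed.

Lemma bdd_sum n (f : 'I_n -> bop H) r : (forall i, bdd r (f i)) ->
  bdd (n%:R * r) (\sum_(i < n) f i).
Proof.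
elim: n f => [|n IH] f bf; first by rewrite big_ord0 mul0r; exact: bdd0.
by rewrite big_ord_recl -natr1 mulrDl mul1r addrC; apply: bddD => //; exact: IH.
Qed.

Lemma orbit_mean_bdd u n r S : unitary u -> bdd r S -> bdd r (orbit_mean u n S).
Proof.
move=> Uu bS; rewrite /orbit_mean.
have := bddZ n.+1%:R^-1 (bdd_sum (fun k : 'I_n.+1 => unitary_conj_bdd (unitaryX k Uu) bS)).
by rewrite nm_nat_inv mulKf // pnatr_eq0.
Qed.

(** The sum telescopes: only its two extreme terms survive. *)
Lemma orbit_mean_almost_fixed u n r S : 0 <= r -> unitary u -> bdd r S ->
  bdd (n.+1%:R^-1 * (r + r)) (u * orbit_mean u n S * adj u - orbit_mean u n S).
Proof.
move=> r0 Uu bS; rewrite /orbit_mean -bop_scaleAr -bop_scaleAl -scalerBr -nm_nat_inv.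
apply: bddZ.
suff -> : u * (\sum_(k < n.+1) u ^+ k * S * adj (u ^+ k)) * adj u -
    \sum_(k < n.+1) u ^+ k * S * adj (u ^+ k) = u ^+ n.+1 * S * adj (u ^+ n.+1) - S.
  by apply: bddD (bddN bS); apply: unitary_conj_bdd => //; exact: unitaryX.
rewrite mulr_sumr mulr_suml.
under eq_bigr => k _ do rewrite !mulrA -exprS -(mulrA (_ * S)) -adjM -exprS.
rewrite -sumrB -(big_mkord xpredT
  (fun k => u ^+ k.+1 * S * adj (u ^+ k.+1) - u ^+ k * S * adj (u ^+ k))).
by rewrite (telescope_sumr (fun k => u ^+ k * S * adj (u ^+ k))) // expr0 mul1r adj1 mulr1.
Qed.

Lemma orbit_mean_comm u v n S : u * v = v * u ->
  v * orbit_mean u n S * adj v - orbit_mean u n S =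
  orbit_mean u n (v * S * adj v - S).
Proof.
move=> uv; rewrite /orbit_mean -bop_scaleAr -bop_scaleAl -scalerBr; congr (_ *: _).
rewrite mulr_sumr mulr_suml -sumrB; apply: eq_bigr => k _.
have ukv : u ^+ k * v = v * u ^+ k by apply/commr_sym/commrX.
by rewrite mulrBr mulrBl !mulrA ukv -!mulrA -!adjM ukv.
Qed.

(** Averaging over one unitary makes S almost fixed by it, and keeps S almost
    fixed by the unitaries treated before, which commute with it
    ([orbit_mean_comm]).  So finitely many unitaries can be treated in turn. *)
Lemma commuting_unitaries_fixed (W C : set (bop H)) r :
  0 <= r ->
  (forall u, W u -> unitary u) ->
  (forall u v, W u -> W v -> u * v = v * u) ->
  C !=set0 -> (forall S, C S -> bdd r S) ->
  (forall u n S, W u -> C S -> C (orbit_mean u n S)) ->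
  exists (F : set_system (bop H)) (z : bop H),
    [/\ ProperFilter F, F C, F --> z & forall u, W u -> u * z = z * u].
Proof.
move=> r0 WU WC [S0 CS0] Cb Cm.
have [||F [z [PF FC Fz uz]]] := @approximate_solutions_limit R H W C
    (fun u S => u * S * adj u - S) r r0 Cb.
- move=> us eps + eps0; elim: us => [|u us IH] Wus; first by exists S0; split.
  have [|S [CS Sus]] := IH.
    by move=> v vus; apply: Wus; rewrite inE vus orbT.
  have Wu : W u by apply: Wus; rewrite mem_head.
  pose n := Num.bound ((r + r) / eps).
  exists (orbit_mean u n S); split; first exact: Cm.
  move=> v; rewrite inE => /orP[/eqP ->|vus]; last first.
    rewrite orbit_mean_comm; last by apply: WC => //; apply: Wus; rewrite inE vus orbT.
    by apply: orbit_mean_bdd; [exact: WU|exact: Sus].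
  apply: bdd_le _ (orbit_mean_almost_fixed n r0 (WU _ Wu) (Cb _ CS)).
  rewrite ler_pdivrMl ?ltr0n // -ler_pdivrMr //.
  have rr : 0 <= (r + r) / eps by rewrite divr_ge0 ?addr_ge0 // ltW.
  by apply/ltW/(lt_trans (archi_boundP rr)); rewrite ltr_nat.
- by move=> u F T PF FT; apply: bop_cvgB => //; exact: bop_cvgM.
exists F, z; split => // u Wu; have [uu _] := WU _ Wu.
by rewrite -{2}(subr0_eq (uz _ Wu)) -(mulrA (u * z)) uu mulr1.
Qed.

End Averaging.

(** * Bimodules of a full Cartan triple *)

Section Cartan.
Variables (R : realType) (H : hilbertType R).
Implicit Types (x y v w u S T : bop H) (c : R[i]).
Variables (M N D : set (bop H)) (E : bop H -> bop H) (B : set (bop H)).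
Hypotheses (full : full_cartan_triple M N D) (fnE : fn_cond_exp M N E).
Hypotheses (Bcl : closed B) (bimB : bimodule N M B).

Let ct := proj1 full.
Let vM : von_neumann M := cartan_vn ct.
Let vN : von_neumann N := proj1 (cartan_sub_N ct).
Let NM : N `<=` M := proj2 (cartan_sub_N ct).
Let vD : von_neumann D := proj1 (cartan_sub_D ct).
Let DE : D = vn_center N := proj2 full.
Let ceE : cond_exp M N E. Proof. by case: fnE. Qed.

Let DN : D `<=` N. Proof. by rewrite DE => d []. Qed.
Let DM : D `<=` M. Proof. by move=> d /DN/NM. Qed.

Let DNC (d n : bop H) : D d -> N n -> d * n = n * d.
Proof. by rewrite DE => -[_ cd] Nn; exact: cd. Qed.

Let DC (d : bop H) : (forall m, N m -> d * m = m * d) -> N d -> D d.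
Proof. by move=> dC Nd; rewrite DE; split. Qed.

Let NC x : M x -> (forall d, D d -> x * d = d * x) -> N x.
Proof. by move=> Mx xD; rewrite (cartan_rel_commutant ct); split. Qed.

Let BD S T : B S -> B T -> B (S + T).
Proof. by move=> BS BT; have := bimodule_lin bimB 1 BS BT; rewrite scale1r. Qed.
Let BZ c T : B T -> B (c *: T).
Proof. by move=> BT; have := bimodule_lin bimB c BT (bimodule0 bimB); rewrite addr0. Qed.
Let Bsum n (f : 'I_n -> bop H) : (forall i, B (f i)) -> B (\sum_(i < n) f i).
Proof.
move=> Bf; elim/big_ind: _ => [|S T BS BT|i _] //; last exact: BD.
exact: (bimodule0 bimB).
Qed.
Let Bl n T : N n -> B T -> B (n * T).
Proof. by move=> Nn BT; have := bimodule_mul bimB Nn (vn1 vN) BT; rewrite mulr1. Qed.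
Let Br n T : N n -> B T -> B (T * n).
Proof. by move=> Nn BT; have := bimodule_mul bimB (vn1 vN) Nn BT; rewrite mul1r. Qed.

Let ED S T : M S -> M T -> E (S + T) = E S + E T.
Proof. by move=> MS MT; have := cond_exp_lin ceE 1 MS MT; rewrite !scale1r. Qed.
Let E0 : E 0 = 0.
Proof. by apply: (cond_exp_id ceE); exact: vn0. Qed.
Let EZ c T : M T -> E (c *: T) = c *: E T.
Proof. by move=> MT; have := cond_exp_lin ceE c MT (vn0 vM); rewrite E0 !addr0. Qed.
Let Esum n (f : 'I_n -> bop H) : (forall i, M (f i)) ->
  E (\sum_(i < n) f i) = \sum_(i < n) E (f i).
Proof.
elim: n f => [|n IH] f Mf; first by rewrite !big_ord0.
rewrite !big_ord_recl ED ?IH //; exact: vn_sum.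
Qed.

Lemma expectation_cvg (I : Type) (F : set_system I) {FF : Filter F}
  (f : I -> bop H) T : M T -> (\forall i \near F, M (f i)) ->
  f @ F --> T -> (E \o f) @ F --> E T.
Proof.
move=> MT Mf fT A; have [_ _ /subspace_continuousP/(_ _ MT) cE] := fnE.
move=> /cE; rewrite /within /= => EA.
by apply: filterS2 Mf (fT _ EA) => i Mi; exact.
Qed.

Section Normalizer.
Variable v : bop H.
Hypothesis GNv : GN M D v.

Lemma GN_in : M v. Proof. by case: GNv. Qed.

Lemma GN_conjl d : D d -> D (adj v * d * v).
Proof. by case: GNv => _ _ + Dd; apply; left; exists d. Qed.

Lemma GN_conjr d : D d -> D (v * d * adj v).
Proof. by case: GNv => _ _ + Dd; apply; right; exists d. Qed.

Lemma GN_source : D (adj v * v).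
Proof. by have := GN_conjl (vn1 vD); rewrite mulr1. Qed.

Lemma GN_range : D (v * adj v).
Proof. by have := GN_conjr (vn1 vD); rewrite mulr1. Qed.

Lemma GN_vvv : v * (adj v * v) = v.
Proof.
case: GNv => _ [pa pp] _; apply/esym/eqP; rewrite -subr_eq0; apply/eqP/adjT_eq0.
set p := adj v * v in pa pp *.
have -> : v - v * p = v * (1 - p) by rewrite mulrBr mulr1.
rewrite adjM -mulrA (mulrA (adj v)) -/p adjB adj1 pa.
by rewrite mulrBr mulr1 pp subrr mulr0.
Qed.

Lemma GN_adj : GN M D (adj v).
Proof.
split; first exact: (vn_adj vM GN_in).
  rewrite /partial_isometry /is_projection adjK adjM adjK; split => //.
  by rewrite -mulrA (mulrA (adj v)) mulrA GN_vvv.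
rewrite adjK => _ [] [d Dd <-]; [exact: GN_conjr|exact: GN_conjl].
Qed.

(** For d in D, v^* d = (v^* d v) v^*; the factor v^* d v is in D, so it passes
    n, and v (v^* d v) = d v. *)
Lemma GN_conj_N n : N n -> N (v * n * adj v).
Proof.
move=> Nn; apply: NC.
  by apply: vnM => //; [apply: vnM => //; [exact: GN_in|exact: NM]|exact: vn_adj GN_in].
move=> d Dd.
have av : adj v * v * adj v = adj v.
  by have := congr1 (@adj R H) GN_vvv; rewrite !adjM adjK.
have e1 : adj v * d = (adj v * d * v) * adj v.
  by rewrite -(mulrA (adj v * d)) -(mulrA (adj v)) (DNC Dd (DN GN_range)) !mulrA av.
have e2 : v * (adj v * d * v) = d * v.
  by rewrite !mulrA -(DNC Dd (DN GN_range)) -!mulrA GN_vvv.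
rewrite -mulrA e1 mulrA -(mulrA v) -(DNC (GN_conjl Dd) Nn) mulrA e2.
by rewrite !mulrA.
Qed.

End Normalizer.

(** C collects what every average of the conjugates of y shares with y; a limit
    of C that commutes with the unitaries of D can only be E y. *)
Lemma expectation_in_bimodule x v : B x -> GN M D v -> B (v * E (adj v * x)).
Proof.
move=> Bx Gv; pose y := adj v * x.
have Mv := GN_in Gv.
have My : M y by apply: vnM => //; [exact: vn_adj|exact: (bimodule_sub bimB)].
have [r r0 by_] := bop_bdd y.
pose C := [set S | [/\ M S, bdd r S, B (v * S) & E S = E y]].
pose W := [set u | D u /\ unitary u].
have [||||||F [z [PF FC Fz Wz]]] := @commuting_unitaries_fixed R H W C r.
- by [].
- by move=> u [].
- by move=> u w [Du _] [/DN Nw _]; exact: DNC.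
- exists y; split => //; rewrite /y mulrA; apply: Bl => //; exact/DN/GN_range.
- by move=> S [].
- move=> u n S [Du Uu] [MS bS BS ES]; split.
  + apply: (vnZ vM); apply: (vn_sum vM) => k.
    have Muk : M (u ^+ k) by apply: DM; exact: (vnX vD k Du).
    by apply: vnM => //; [exact: vnM|exact: vn_adj].
  + exact: orbit_mean_bdd.
  + rewrite /orbit_mean -bop_scaleAr mulr_sumr; apply: BZ; apply: Bsum => k.
    have Duk : D (u ^+ k) by exact: (vnX vD k Du).
    have -> : v * (u ^+ k * S * adj (u ^+ k)) =
       (v * u ^+ k * adj v) * (v * S) * adj (u ^+ k).
      have -> : v * u ^+ k * adj v * (v * S) = v * u ^+ k * (adj v * v) * S.
        by rewrite !mulrA.
      rewrite -(mulrA v) (DNC Duk (DN (GN_source Gv))) (mulrA v (adj v * v)) GN_vvv //.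
      by rewrite !mulrA.
    apply: Br; first by apply: DN; exact: (vn_adj vD Duk).
    by apply: Bl => //; apply: DN; exact: GN_conjr.
  + have Muk k : M (u ^+ k * S * adj (u ^+ k)).
      have Muk : M (u ^+ k) by apply: DM; exact: (vnX vD k Du).
      by apply: vnM => //; [exact: vnM|exact: vn_adj].
    rewrite /orbit_mean EZ; last exact: vn_sum.
    rewrite Esum // (eq_bigr (fun=> E y)) => [|k _].
      by rewrite sumr_const card_ord -(scaler_nat n.+1 (E y)) scalerA mulVf ?scale1r //.
    have Duk : D (u ^+ k) by exact: (vnX vD k Du).
    have [_ uu] := unitaryX k Uu.
    rewrite (cond_exp_bimod ceE) ?ES //; [|exact: DN|by apply: DN; exact: (vn_adj vD Duk)].
    have NEy : N (E y) by exact: (cond_exp_in ceE).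
    by rewrite (DNC Duk NEy) -mulrA uu mulr1.
have FM : F M by apply: filterS FC => S [].
have Mz : M z by exact: (vn_cvg vM Fz).
have zD d : D d -> z * d = d * z.
  move=> /(four_unitaries vD)[c [u [Du ->]]].
  rewrite mulr_sumr mulr_suml; apply: eq_bigr => i _.
  by rewrite -bop_scaleAr -bop_scaleAl Wz //; exact: Du.
have Nz : N z by exact: NC.
have Ez : E z = E y.
  have EF : E @ F --> E z by exact: (@expectation_cvg _ F _ id z Mz FM Fz).
  apply: (bop_cvg_unique EF); apply: cvg_near_cst.
  by apply: filterS FC => S [].
rewrite -/y -Ez (cond_exp_id ceE Nz).
apply: (closed_cvg _ Bcl _ _ (bop_cvgMl v Fz)).
by apply: filterS FC => S [].
Qed.

(** The unitary u commutes with D, so it drops out of all three expressions that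
    define membership of v z u in GN(M, D). *)
Lemma GN_mul_unitary v z u : GN M D v -> D z -> adj z = z -> z * z = z ->
  N u -> unitary u -> B (v * z) -> (GN M D `&` B) (v * (z * u)).
Proof.
move=> Gv Dz za zz Nu [u1 u2] Bvz.
have Mv := GN_in Gv.
have Dp := GN_source Gv.
have cancel p : D p -> adj u * (z * (p * z) * u) = z * p.
  move=> Dp'; have Dzp : D (z * p) by exact: vnM.
  by rewrite (DNC Dp' (DN Dz)) (mulrA z) zz (DNC Dzp Nu) mulrA u1 mul1r.
split; last by rewrite mulrA; exact: Br.
split.
- by apply: (vnM vM Mv); apply: NM; apply: (vnM vN _ Nu); exact: DN.
- rewrite /partial_isometry.
  have -> : adj (v * (z * u)) * (v * (z * u)) = z * (adj v * v).
    by rewrite -(cancel _ Dp) !adjM za !mulrA.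
  case: Gv => _ [pa pp] _.
  have pz := DNC Dp (DN Dz); split.
    by rewrite adjM pa za.
  by rewrite -mulrA (mulrA _ z) pz -(mulrA z) pp mulrA zz.
move=> _ [] [d Dd <-]; rewrite !adjM za.
  have Dvdv := GN_conjl Gv Dd.
  have -> : adj u * z * adj v * d * (v * (z * u)) = z * (adj v * d * v).
    by rewrite -(cancel _ Dvdv) !mulrA.
  exact: vnM.
have -> : v * (z * u) * d * (adj u * z * adj v) = v * (z * d) * adj v.
  have -> : v * (z * u) * d * (adj u * z * adj v) = v * (z * ((u * d) * adj u * z)) * adj v.
    by rewrite !mulrA.
  by rewrite -(DNC Dd Nu) -(mulrA d) u2 mulr1 (DNC Dd (DN Dz)) (mulrA z) zz.
by apply: GN_conjr => //; exact: vnM.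
Qed.

(** The n in N with v n in B form an ideal: v a n = (v a v^* ) (v n) for a in N,
    as v^* v is central in N, and v a v^* is in N. *)
Lemma central_support v : GN M D v -> exists z, [/\ D z, adj z = z, z * z = z,
  B (v * z) & forall n, N n -> B (v * n) -> z * n = n].
Proof.
move=> Gv.
pose J := [set n | N n /\ B (v * n)].
have Dp := GN_source Gv.
have [|||||| z [[Nz Bz] za zJ zN]] := @ideal_central_unit R H N J vN.
- by move=> n [].
- by split; [exact: vn0|rewrite mulr0; exact: (bimodule0 bimB)].
- by move=> S T [NS BS] [NT BT]; split; [exact: vnD|rewrite mulrDr; exact: BD].
- move=> a m Na [Nm Bm]; split; first exact: vnM.
  have -> : v * (a * m) = (v * a * adj v) * (v * m).
    have -> : v * a * adj v * (v * m) = v * (a * (adj v * v)) * m by rewrite !mulrA.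
    by rewrite -(DNC Dp Na) (mulrA v (adj v * v)) GN_vvv // !mulrA.
  by apply: Bl => //; exact: GN_conj_N.
- by move=> a m Na [Nm Bm]; split; [exact: vnM|rewrite mulrA; exact: Br].
- move=> F T PF FT FJ; split.
    by apply: (vn_cvg vN FT); apply: filterS FJ => S [].
  apply: (closed_cvg _ Bcl _ _ (bop_cvgMl v FT)).
  by apply: filterS FJ => S [].
exists z; split => //.
- exact: DC.
- exact: zJ.
- by move=> n Nn Bn; apply: zJ.
Qed.

Lemma expectation_decomposition x v : B x -> GN M D v ->
  exists (k : nat) (c : 'I_k -> R[i]) (w : 'I_k -> bop H),
    [/\ (k <= 4)%N, forall i, (GN M D `&` B) (w i) &
      v * E (adj v * x) = \sum_(i < k) c i *: w i].
Proof.
move=> Bx Gv.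
have BvE := expectation_in_bimodule Bx Gv.
have My : M (adj v * x).
  by apply: vnM => //; [exact: (vn_adj vM (GN_in Gv))|exact: (bimodule_sub bimB)].
have NE : N (E (adj v * x)) by exact: (cond_exp_in ceE).
have [z [Dz za zz Bvz zn]] := central_support Gv.
have [c [u [Nu nE]]] := four_unitaries vN NE.
exists 4%N, c, (fun i => v * (z * u i)); split => //.
  by move=> i; have [Nui Uui] := Nu i; exact: GN_mul_unitary.
rewrite -[in LHS](zn _ NE BvE) nE mulr_sumr mulr_sumr; apply: eq_bigr => i _.
by rewrite -!bop_scaleAr.
Qed.

(** Since v = (v v^* ) v with v v^* in D, the hypothesis on the adjoint of v gives
    E (v x) = 0 for every v in GN(M, D). *)
Lemma expectation_separates x : M x ->
  (forall v, GN M D v -> v * E (adj v * x) = 0) -> x = 0.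
Proof.
move=> Mx vE.
have EGN v : GN M D v -> E (v * x) = 0.
  move=> Gv; have Gv' := GN_adj Gv; have := vE _ Gv'; rewrite adjK => e.
  have Mvx : M (v * x) by apply: vnM => //; exact: GN_in.
  have -> : v * x = v * adj v * (v * x) * 1.
    by rewrite mulr1 !mulrA -(mulrA v) GN_vvv.
  rewrite (cond_exp_bimod ceE) ?mulr1 //; last exact: vn1.
    by rewrite -mulrA e mulr0.
  exact/DN/GN_range.
have Espan T : lspan (GN M D) T -> M T /\ E (T * x) = 0.
  move=> [n [c [a [Ga ->]]]]; split.
    by apply: vn_sum => // i; apply: vnZ => //; exact: GN_in.
  have Ma i : M (c i *: a i * x).
    by apply: vnM => //; apply: vnZ => //; exact: GN_in.
  rewrite mulr_suml Esum // big1 // => i _.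
  by rewrite -bop_scaleAl EZ ?EGN ?scaler0 //; apply: vnM => //; exact: GN_in.
have : closure (lspan (GN M D)) (adj x) by apply: (cartan_regular ct); exact: vn_adj.
move=> cl.
pose F := within (lspan (GN M D)) (nbhs (adj x)).
have PF : ProperFilter F by exact: within_nbhs_proper.
have Fx : F --> adj x by exact: cvg_within.
have FS : F (lspan (GN M D)) by rewrite /F /within /=; exact: filterE.
have Mxx : M (adj x * x) by apply: vnM => //; exact: vn_adj.
have Exx : E (adj x * x) = 0.
  have FMx : \forall T \near F, M (T * x).
    by apply: filterS FS => T /Espan[MT _]; exact: vnM.
  have EF : (fun T => E (T * x)) @ F --> E (adj x * x).
    exact: (expectation_cvg Mxx FMx (bop_cvgMr x Fx)).
  apply: (bop_cvg_unique EF); apply: cvg_near_cst.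
  by apply: filterS FS => T /Espan[].
apply: adjT_eq0; have [_ fa _] := fnE; apply: fa => //.
by move=> y; rewrite bop_mulE -adjEr ip_nm ler0c sqr_ge0.
Qed.

End Cartan.

Theorem theorem5p2 (R : realType) (H : hilbertType R)
    (M N D : set (bop H)) (E : bop H -> bop H) (B : set (bop H)) :
  full_cartan_triple M N D ->
  fn_cond_exp M N E ->
  [set 0] <> B ->
  closed B ->
  bimodule N M B ->
  [set 0] <> GN M D `&` B /\
  (forall x v : bop H, B x -> GN M D v ->
     exists (k : nat) (c : 'I_k -> R[i]) (w : 'I_k -> bop H),
       [/\ (k <= 4)%N,
           forall i, (GN M D `&` B) (w i) &
           v * E (adj v * x) = \sum_(i < k) c i *: w i]).
Proof.
move=> full fnE B0 Bcl bimB.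
have dec := expectation_decomposition full fnE Bcl bimB.
split => // GB0; apply: B0; apply/seteqP; split=> [_ ->|x Bx]; first exact: (bimodule0 bimB).
apply: (expectation_separates full fnE); first exact: (bimodule_sub bimB).
move=> v Gv; have [k [c [w [_ GBw ->]]]] := dec x v Bx Gv.
by rewrite big1 // => i _; have := GBw i; rewrite -GB0 => ->; rewrite scaler0.
Qed.
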